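(* Let $n$ be a positive integer, and let $r\ge 1$ be a real number. Then the class of intersection graphs of families of compact convex sets of aspect ratio at most $r$ in $\mathbb{R}^n$ has asymptotic dimension at most $n+1$.
   Context: For a subset $S$ of $\mathbb{R}^n$ (Euclidean metric), the height of $S$ is the infimum of $h>0$ such that $S$ is contained between two parallel hyperplanes at distance $h$, and the aspect ratio of $S$ is the ratio of the diameter of $S$ to the height of $S$ (defined when the height is positive). Families are multisets and may be finite or infinite. The intersection graph of a family $\mathcal{A}$ of sets is the (finite or infinite) simple graph with vertex set $\mathcal{A}$ in which two distinct vertices (members) $S_1,S_2$ are adjacent iff $S_1\cap S_2\neq\emptyset$. A graph $G$ is viewed as an extended metric space (distances may be $+\infty$) $(V(G),\operatorname{dist}_G)$, where $\operatorname{dist}_G(u,v)$ is the infimum of the number of edges of paths between $u$ and $v$. In an extended metric space $(X,d)$: $\operatorname{diam}(U)=\sup_{x,y\in U}d(x,y)$; for $\rho>0$ a collection $\mathcal{U}$ of subsets is $\rho$-disjoint if $\inf_{u\in U,u'\in U'}d(u,u')>\rho$ for all distinct $U,U'\in\mathcal{U}$. For an integer $m\ge 0$, a function $f:\mathbb{R}_+\to\mathbb{R}_+$ is an $m$-dimensional control function for $(X,d)$ if for every positive integer $\rho$ there is a cover $\mathcal{U}=\bigcup_{i=1}^{m+1}\mathcal{U}_i$ of $X$ with $\operatorname{diam}(U)\le f(\rho)$ for all $U\in\mathcal{U}$ and each $\mathcal{U}_i$ being $\rho$-disjoint. A class $\mathcal{G}$ of (finite or infinite) graphs has asymptotic dimension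 at most $m$ if some single function $f:\mathbb{R}_+\to\mathbb{R}_+$ is an $m$-dimensional control function for all graphs in $\mathcal{G}$. *)

(* Defs.v *)
From HB Require Import structures.
From mathcomp Require Import all_boot all_order all_algebra.
From mathcomp Require Import all_classical all_reals all_analysis.

Set Implicit Arguments.
Unset Strict Implicit.
Unset Printing Implicit Defensive.

Import Order.TTheory GRing.Theory Num.Theory.
Import numFieldNormedType.Exports.

Local Open Scope classical_set_scope.
Local Open Scope ring_scope.

(* The norm the library puts on row vectors is the sup norm, hence this
   explicit Euclidean structure.  The topology (used for [compact]) is the
   same for both norms. *)
Definition dotprod (R : realType) (n : nat) (x y : 'rV[R]_n) : R :=
  \sum_(i < n) x 0 i * y 0 i.

Definition eucl_norm (R : realType) (n : nat) (x : 'rV[R]_n) : R :=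
  Num.sqrt (dotprod x x).

Definition eucl_dist (R : realType) (n : nat) (x y : 'rV[R]_n) : \bar R :=
  (eucl_norm (x - y))%:E.

(* Extended metrics are given by their distance function [d]; the diameter of
   the empty set is [-oo] here. *)
Definition diam (R : realType) (X : Type) (d : X -> X -> \bar R)
    (U : set X) : \bar R :=
  ereal_sup [set d x y | x in U & y in U].

(* [u] is a unit normal vector, so the parallel hyperplanes [<u, x> = c] and
   [<u, x> = c + h] are at distance [h]. *)
Definition between_hyperplanes (R : realType) (n : nat) (S : set 'rV[R]_n)
    (h : R) : Prop :=
  exists (u : 'rV[R]_n) (c : R), eucl_norm u = 1 /\
    forall x, S x -> c <= dotprod u x <= c + h.

Definition height (R : realType) (n : nat) (S : set 'rV[R]_n) : \bar R :=
  ereal_inf [set h%:E | h in [set h : R | 0 < h /\ between_hyperplanes S h]].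

Definition aspect_ratio (R : realType) (n : nat) (S : set 'rV[R]_n) : \bar R :=
  (diam (@eucl_dist R n) S / height S)%E.

(* The aspect ratio is defined only for sets of positive height. *)
Definition aspect_ratio_le (R : realType) (n : nat) (r : R)
    (S : set 'rV[R]_n) : Prop :=
  (0 < height S)%E /\ (aspect_ratio S <= r%:E)%E.

Record sgraph : Type := SGraph {
  vertex :> Type;
  adj : vertex -> vertex -> Prop;
  adj_sym : forall u v, adj u v -> adj v u;
  adj_irrefl : forall u, ~ adj u u
}.

(* [p 0, ..., p k] is a path with [k] edges from [u] to [v]; the values of [p]
   beyond [k] are irrelevant. *)
Definition is_path (G : sgraph) (u v : G) (k : nat) (p : nat -> G) : Prop :=
  [/\ p 0%N = u, p k = v,
      forall i, (i < k)%N -> adj (p i) (p i.+1) &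
      forall i j, (i <= k)%N -> (j <= k)%N -> p i = p j -> i = j].

Definition graph_dist (R : realType) (G : sgraph) (u v : G) : \bar R :=
  ereal_inf [set (k%:R)%:E | k in [set k : nat | exists p, is_path u v k p]].

(* A family (multiset) is an indexed family [A : I -> set T] over an arbitrary
   index type; its members, counted with multiplicity, are the indices. *)
Definition inter_adj (T I : Type) (A : I -> set T) (i j : I) : Prop :=
  i <> j /\ A i `&` A j !=set0.

Lemma inter_adj_sym (T I : Type) (A : I -> set T) (i j : I) :
  inter_adj A i j -> inter_adj A j i.
Proof. by case=> ij Aij; split; [exact/nesym | rewrite setIC]. Qed.

Lemma inter_adj_irrefl (T I : Type) (A : I -> set T) (i : I) :
  ~ inter_adj A i i.
Proof. by case. Qed.

Definition intersection_graph (T I : Type) (A : I -> set T) : sgraph :=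
  SGraph (@inter_adj_sym T I A) (@inter_adj_irrefl T I A).

Definition intersection_graphs (T : Type) (P : set T -> Prop) : sgraph -> Prop :=
  fun G => exists (I : Type) (A : I -> set T),
    (forall i, P (A i)) /\ G = intersection_graph A.

Definition rho_disjoint (R : realType) (X : Type) (d : X -> X -> \bar R)
    (rho : R) (F : set (set X)) : Prop :=
  forall U U' : set X, F U -> F U' -> U <> U' ->
    (rho%:E < ereal_inf [set d u u' | u in U & u' in U'])%E.

Definition control_function (R : realType) (X : Type) (d : X -> X -> \bar R)
    (m : nat) (f : {nonneg R} -> {nonneg R}) : Prop :=
  forall rho : nat, (0 < rho)%N ->
    exists F : 'I_m.+1 -> set (set X),
      [/\ forall x : X, exists i U, F i U /\ U x,
          forall i U, F i U -> (diam d U <= (f rho%:R%:nng)%:num%:E)%E &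
          forall i, rho_disjoint d rho%:R (F i)].

Definition asdim_le (R : realType) (C : sgraph -> Prop) (m : nat) : Prop :=
  exists f : {nonneg R} -> {nonneg R},
    forall G, C G -> control_function (@graph_dist R G) m f.

(* Main.v *)
(* It suffices to colour the members with [n + 2] colours so that monochromatic
   [rho]-chains have bounded diameter, and by compactness it suffices to do so
   for finite families.  A convex set of aspect ratio at most [r] contains, near
   each of its points and at every scale up to its size, a point of a lattice
   whose mesh is a fixed fraction of that scale; hence boundedly many pairwise
   disjoint members of size at least [s] meet a given cube of side [s].

   Take [n + 2] laminar families of grid cells such that, at every scale, every
   point is deep inside a cell of at least two of them.  For each family, the
   members that are deep inside a cell of the scale of the largest member
   nearby carry a tree-like structure (the forest of cells) whose bags are
   covered by boundedly many balls.  As for graphs of bounded treewidth, such a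
   structure has asymptotic dimension 1: it contains a set [Y] such that both
   [Y] and its complement have bounded components.  Choosing the sets [Y] of the
   different families pairwise disjoint, every member avoids the [Y] of one of
   its two families, and the family gives the colour. *)
Require Import Defs.
From mathcomp Require Import all_boot all_order all_algebra.
From mathcomp Require Import all_classical all_reals all_analysis.
From mathcomp Require Import perm zify ring lra.

Set Implicit Arguments.
Unset Strict Implicit.
Unset Printing Implicit Defensive.

(** * Chains and packings *)

Section Chains.
Variables (V : Type) (E : V -> V -> Prop).

Inductive chain (S : V -> Prop) : V -> V -> Prop :=
| chain_nil x : S x -> chain S x x
| chain_cons x y z : S x -> E x y -> chain S y z -> chain S x z.

Lemma chain_head S x y : chain S x y -> S x.
Proof. by case. Qed.

Lemma chain_last S x y : chain S x y -> S y.
Proof. by elim. Qed.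

Lemma chain_sub (S S' : V -> Prop) x y :
  (forall v, S v -> S' v) -> chain S x y -> chain S' x y.
Proof.
move=> sub; elim=> [u Su|u v w Su uv _ vw]; first exact/chain_nil/sub.
exact: chain_cons (sub _ Su) uv vw.
Qed.

Lemma chain_trans S x y z : chain S x y -> chain S y z -> chain S x z.
Proof.
by elim=> // u v w Su uv _ IH /IH vz; exact: chain_cons Su uv vz.
Qed.

Lemma chain_sym S x y :
  (forall u v, E u v -> E v u) -> chain S x y -> chain S y x.
Proof.
move=> Esym; elim=> [u Su|u v w Su uv vw wv]; first exact: chain_nil.
apply: chain_trans wv _; apply: chain_cons (Esym _ _ uv) _.
  exact: chain_head vw.
exact: chain_nil.
Qed.

Lemma chain_reach S x y :
  chain S x y -> chain (fun v => S v /\ chain S x v) x y.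
Proof.
suff H u : chain S u y -> chain S x u ->
    chain (fun v => S v /\ chain S x v) u y.
  by move=> xy; apply: H => //; apply: chain_nil; exact: chain_head xy.
elim=> [v Sv xv|v w z Sv vw wz IH xv]; first exact: chain_nil.
apply: (chain_cons _ vw) => //.
apply: IH; apply: chain_trans xv _; apply: chain_cons Sv vw _.
exact/chain_nil/(chain_head wz).
Qed.

(** Split at the last visit to [Q]: the chain after it avoids [Q]. *)
Lemma chain_exit (S Q : V -> Prop) x y : chain S x y ->
  [\/ chain (fun v => S v /\ ~ Q v) x y, Q y
    | exists u v, [/\ S u, Q u, E u v & chain (fun v => S v /\ ~ Q v) v y]].
Proof.
elim=> [u Su|u v w Su uv _ IH].
  by have [Qu|nQ] := pselect (Q u); [constructor 2|constructor 1; exact: chain_nil].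
case: IH => [c|Qw|[a [b [Sa Qa ab c]]]]; last 2 first.
- by constructor 2.
- by constructor 3; exists a, b.
have [Qu|nQ] := pselect (Q u); first by constructor 3; exists u, v.
by constructor 1; apply: chain_cons uv c.
Qed.

End Chains.

Lemma chain_mono V (E E' : V -> V -> Prop) (S S' : V -> Prop) x y :
  (forall u, S u -> S' u) ->
  (forall u v, S u -> S v -> E u v -> E' u v) ->
  chain E S x y -> chain E' S' x y.
Proof.
move=> sS sE; elim=> [u Su|u v w Su uv vw IH]; first exact/chain_nil/sS.
by apply: chain_cons IH; [exact: sS|exact: sE (chain_head vw) uv].
Qed.

(* [dl m x y] stands for [d x y <= m] for an integer-valued extended metric. *)
Definition is_ndist V (dl : nat -> V -> V -> Prop) : Prop :=
  [/\ forall x, dl 0%N x x,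
      forall m x y, dl m x y -> dl m y x,
      forall m m' x y, (m <= m')%N -> dl m x y -> dl m' x y &
      forall m m' x y z, dl m x y -> dl m' y z -> dl (m + m')%N x z].

Definition bounded V (dl : nat -> V -> V -> Prop) (E : V -> V -> Prop)
    (S : V -> Prop) (R : nat) : Prop :=
  forall x y, chain E S x y -> dl R x y.

(* No [k + 1] points of [S] are pairwise at distance more than [r]. *)
Fixpoint pack V (dl : nat -> V -> V -> Prop) (r k : nat) (S : V -> Prop) : Prop :=
  if k is k'.+1
  then forall x, S x -> pack dl r k' (fun v => S v /\ ~ dl r v x)
  else forall x, ~ S x.

Section Packing.
Variables (V : Type) (dl : nat -> V -> V -> Prop).
Hypothesis dlP : is_ndist dl.

Lemma dl0 m x : dl m x x.
Proof. by case: dlP => d0 _ dm _; exact: dm (d0 x). Qed.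

Lemma dl_sym m x y : dl m x y -> dl m y x.
Proof. by case: dlP => _ ds _ _; exact: ds. Qed.

Lemma dl_le m m' x y : (m <= m')%N -> dl m x y -> dl m' x y.
Proof. by case: dlP => _ _ dm _; exact: dm. Qed.

Lemma dl_trans m m' p x y z :
  (m + m' <= p)%N -> dl m x y -> dl m' y z -> dl p x z.
Proof.
by case: dlP => _ _ _ dt mp xy yz; exact: dl_le mp (dt _ _ _ _ _ xy yz).
Qed.

Lemma pack_sub r k (S S' : V -> Prop) :
  (forall v, S v -> S' v) -> pack dl r k S' -> pack dl r k S.
Proof.
elim: k S S' => [|k IH] S S' sub pS' x Sx; first by move/sub/pS' in Sx.
by apply: IH (pS' x (sub _ Sx)) => v [/sub].
Qed.

Lemma pack_nbhd r t k (S : V -> Prop) : pack dl r k S ->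
  pack dl (r + (t + t)) k (fun v => exists2 z, S z & dl t z v).
Proof.
elim: k S => [|k IH] S pS x [z Sz zx]; first by case: (pS z).
apply: pack_sub (IH _ (pS z Sz)) => v [[z' Sz' z'v] nvx].
exists z' => //; split=> // z'z; apply: nvx.
apply: (dl_trans _ (dl_sym z'v) (dl_trans (leqnn _) z'z zx)).
by rewrite addnCA.
Qed.

(** Cut after the last point within [r] of [x]: getting past it costs at most [r + h], and the rest
    avoids this ball, which lowers the packing number by one. *)
Lemma pack_chain E (S S' : V -> Prop) r k h x y :
  (forall u v, S u -> S v -> E u v -> dl h u v) ->
  (forall v, S v -> S' v) ->
  pack dl r k S' -> chain E S x y -> dl (k * (r + h)) x y.
Proof.
elim: k S S' x => [|k IH] S S' x Eh sub pS xy.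
  by case: (pS x); exact/sub/(chain_head xy).
case: (chain_exit (fun v => dl r v x) xy) => [c|yx|[u [v [Su ux uv c]]]].
- by case: (chain_head c) => _ []; exact: dl0.
- by apply: dl_le (dl_sym yx); rewrite mulSn -addnA leq_addr.
- have Sv := (chain_head c).1.
  have px := pS x (sub _ (chain_head xy)).
  have vy : dl (k * (r + h)) v y.
    apply: IH px c; first by move=> a b [Sa _] [Sb _]; exact: Eh.
    by move=> a [/sub].
  have xv := dl_trans (leqnn _) (dl_sym ux) (Eh _ _ Su Sv uv).
  by apply: dl_trans xv vy; rewrite mulSn.
Qed.

End Packing.

(** * Two-colourings along a forest *)

(* The [e d]-classes for all [d] form a rooted forest, coarsest at [d = 0];
   [v] is placed at the node [e (lv v) v], and [H]-adjacent points lie on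
   comparable nodes. *)
Definition forested V (dl : nat -> V -> V -> Prop) (h : nat) (P : V -> Prop)
    (H : V -> V -> Prop) (lv : V -> nat) (e : nat -> V -> V -> Prop) : Prop :=
  [/\ forall x y, H x y -> H y x,
      forall x y, P x -> P y -> H x y -> dl h x y,
      forall d, [/\ forall x, e d x x, forall x y, e d x y -> e d y x &
                    forall x y z, e d x y -> e d y z -> e d x z],
      forall d x y, e d.+1 x y -> e d x y &
      forall x y, P x -> P y -> H x y -> e (minn (lv x) (lv y)) x y].

(* The bag of the node [e d w] in the tree-decomposition of [H] given by the
   forest. *)
Definition tree_bag V (P : V -> Prop) (H : V -> V -> Prop) (lv : V -> nat)
    (e : nat -> V -> V -> Prop) (d : nat) (w v : V) : Prop :=
  [/\ P v, (lv v <= d)%N &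
   exists v', [/\ P v', v' = v \/ H v v', (d <= lv v')%N & e d v' w]].

(** * Eras along the branches of the forest *)

Section Eras.
Variables (V : Type) (dl : nat -> V -> V -> Prop).
Hypothesis dlP : is_ndist dl.
Variables (h : nat) (P : V -> Prop) (H : V -> V -> Prop) (lv : V -> nat)
  (e : nat -> V -> V -> Prop).
Hypothesis fP : forested dl h P H lv e.

Let bag := tree_bag P H lv e.

Lemma H_sym x y : H x y -> H y x. Proof. by case: fP => + _ _ _ _; apply. Qed.
Lemma H_dl x y : P x -> P y -> H x y -> dl h x y.
Proof. by case: fP => _ + _ _ _; apply. Qed.
Lemma e_refl d x : e d x x. Proof. by case: fP => _ _ /(_ d)[]. Qed.
Lemma e_sym d x y : e d x y -> e d y x.
Proof. by case: fP => _ _ /(_ d)[_ + _] _ _; apply. Qed.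
Lemma e_trans d x y z : e d x y -> e d y z -> e d x z.
Proof. by case: fP => _ _ /(_ d)[_ _ +] _ _; apply. Qed.
Lemma e_le d d' x y : (d' <= d)%N -> e d x y -> e d' x y.
Proof.
case: fP => _ _ _ eS _; elim: d => [|d IH]; first by rewrite leqn0 => /eqP->.
by rewrite leq_eqVlt => /predU1P[->//|]; rewrite ltnS => /IH + /eS; apply.
Qed.
Lemma H_e x y d : P x -> P y -> H x y -> (d <= lv x)%N -> (d <= lv y)%N -> e d x y.
Proof.
case: fP => _ _ _ _ he Px Py xy dx dy; apply: e_le (he _ _ Px Py xy).
by rewrite leq_min dx.
Qed.

Lemma bag_e d w w' v : e d w w' -> bag d w v -> bag d w' v.
Proof.
move=> ww' [Pv vd [v' [Pv' vv' dv' v'w]]]; split=> //; exists v'; split=> //.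
exact: e_trans v'w ww'.
Qed.

Lemma bag_self v : P v -> bag (lv v) v v.
Proof.
by move=> Pv; split=> //; exists v; split => //; [left|exact: e_refl].
Qed.

Definition near m d w x := exists2 z, bag d w z & dl m z x.

Lemma near_e m d w w' x : e d w w' -> near m d w x -> near m d w' x.
Proof. by move=> ww' [z /(bag_e ww') bz zx]; exists z. Qed.

Lemma near_trans m m' p d w x y : (m + m' <= p)%N ->
  near m d w x -> dl m' x y -> near p d w y.
Proof. by move=> mp [z bz zx] xy; exists z => //; exact: (dl_trans dlP mp zx xy). Qed.

Variable T : nat.

(* Going down a branch, an era lasts as long as the current bag has a point at
   distance at most [T] from the bag at which the era started; [era d w] is
   the depth of the start of the era of the node [e d w]. *)
Fixpoint era d w := if d is d'.+1
  then if `[< exists2 x, bag d'.+1 w x & near T (era d' w) w x >]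
       then era d' w else d'.+1
  else 0%N.

Lemma era_le d w : (era d w <= d)%N.
Proof. by elim: d => //= d IH; case: asboolP => // _; exact: leqW. Qed.

Lemma era_e d w w' : e d w w' -> era d w = era d w'.
Proof.
elim: d w w' => //= d IH w w' ww'.
have ww := e_le (leqnSn d) ww'.
rewrite -(IH _ _ ww); congr (if _ then _ else _).
have wE : e (era d w) w w' by apply: e_le ww; exact: era_le.
apply: asbool_equiv_eq; split=> -[x bx nx]; exists x.
- exact: bag_e bx.
- exact: near_e nx.
- exact: bag_e (e_sym ww') bx.
- exact: near_e (e_sym wE) nx.
Qed.

Lemma era_convex d j w : (era d w <= j)%N -> (j <= d)%N -> era j w = era d w.
Proof.
elim: d => [|d IH]; first by rewrite leqn0 => _ /eqP->.
rewrite [j <= _]leq_eqVlt => + /predU1P[->//|]; rewrite ltnS => + jd.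
by rewrite /=; case: asboolP => [_|_ dj]; [move/IH; apply|
  rewrite leqNgt dj in jd].
Qed.

Lemma era_start s w x : era s.+1 w = s.+1 -> bag s.+1 w x -> ~ near T (era s w) w x.
Proof.
move=> /=; case: asboolP => [_ E|nE _ bx nx]; last by apply: nE; exists x.
by have := era_le s w; rewrite E ltnn.
Qed.

(** The era of a point is that of its own node; its distance to the bag opening this era will decide
    its colour. *)
Definition ev v := era (lv v) v.
Definition del m v := near m (ev v) v v.

Lemma del_le m m' v : (m <= m')%N -> del m v -> del m' v.
Proof. by move=> mm' [z bz zv]; exists z => //; exact: (dl_le dlP mm' zv). Qed.

Lemma edge_same u v : P u -> P v -> H u v -> (lv u <= lv v)%N ->
  (ev v <= lv u)%N -> ev u = ev v.
Proof.
move=> Pu Pv uv le_uv ev_u; rewrite /ev -(era_convex ev_u le_uv).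
exact/era_e/H_e.
Qed.

Lemma edge_bag u v d : P u -> P v -> H u v -> (lv u <= d)%N -> (d <= lv v)%N ->
  bag d v u.
Proof.
by move=> Pu Pv uv ud dv; split=> //; exists v; split=> //; [right|exact: e_refl].
Qed.

(** Such an edge puts [u] into the bag opening the era of [v]. An era opens only when the whole bag
    is farther than [T] from the previous opening bag, so [u] is a remote point of the previous
    era. *)
Lemma edge_cross u v : P u -> P v -> H u v -> (lv u < ev v)%N ->
  [/\ del h v, ~ del T u & ev u = era (ev v).-1 v].
Proof.
move=> Pu Pv uv lu; have evv : (ev v <= lv v)%N := era_le _ _.
have uB : bag (ev v) v u by apply: edge_bag => //; exact: ltnW.
split; first by exists u => //; apply: H_dl.
all: have ev0 : era (ev v) v = ev v by apply: era_convex.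
all: case E : (ev v) lu evv uB ev0 => [//|s]; rewrite ltnS => us sv uB ev0.
all: have nu := era_start ev0 uB.
(* Otherwise the edge to [v] would put [u] into the previous opening bag itself. *)
all: have su : (era s v <= lv u)%N.
1, 3: rewrite leqNgt; apply/negP => us'; apply: nu; exists u;
  [|exact: (dl0 dlP)]; apply: edge_bag => //;
  [exact: ltnW|exact: leq_trans (era_le _ _) (ltnW sv)].
all: have uvu : e (lv u) u v by apply: H_e => //; exact: leq_trans us (ltnW sv).
all: have evu : ev u = era s v by rewrite /ev (era_e uvu); exact: era_convex.
- rewrite /del evu => du; apply: nu; apply: near_e du.
  exact: e_le uvu.
- exact: evu.
Qed.

Lemma same_e u v : P u -> P v -> H u v -> ev u = ev v -> e (ev u) u v.
Proof.
by move=> Pu Pv uv E; apply: H_e => //; [|rewrite E]; exact: era_le.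
Qed.

Lemma edge_del m u v : P u -> P v -> H u v -> ev u = ev v ->
  del m u -> del (m + h) v.
Proof.
move=> Pu Pv uv E du; rewrite /del -E.
apply: (near_trans (leqnn _) _ (H_dl Pu Pv uv)).
exact: near_e (same_e Pu Pv uv E) du.
Qed.

Lemma edgeVcross u v : P u -> P v -> H u v ->
  [\/ ev u = ev v, (lv u < ev v)%N | (lv v < ev u)%N].
Proof.
move=> Pu Pv uv; have [uv'|vu'] := leqP (lv u) (lv v).
- have [lu|lu] := ltnP (lv u) (ev v); first by constructor 2.
  by constructor 1; apply: edge_same.
- have [lu|lu] := ltnP (lv v) (ev u); first by constructor 3.
  by constructor 1; apply/esym/edge_same => //; [exact: H_sym|exact: ltnW].
Qed.

(* Edges of the auxiliary structure on the points far from the start of their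
   era: points that are about to be merged by a common later era are also
   joined. *)
Definition aux_edge h' u v := ev u = ev v /\
  (H u v \/ dl h' u v /\ exists s w,
     [/\ bag s w u, bag s w v, (lv u < s)%N & (lv v < s)%N]).

Lemma bag_lt_witness s w u : bag s w u -> (lv u < s)%N ->
  exists v', [/\ P v', H u v', (s <= lv v')%N, e s v' w & e (lv u) u w].
Proof.
move=> [Pu _ [v' [Pv' uv' sv' v'w]]] us.
have {}uv' : H u v'.
  by case: uv' => // E; rewrite E leqNgt us in sv'.
exists v'; split=> //; apply: e_trans (e_le (ltnW us) v'w).
by apply: H_e => //; exact: leq_trans (ltnW us) sv'.
Qed.

Lemma aux_edge_e h' u v : P u -> P v -> aux_edge h' u v ->
  e (minn (lv u) (lv v)) u v.
Proof.
move=> Pu Pv [_ [uv|[_ [s [w [bu bv us vs]]]]]].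
  by apply: H_e => //; rewrite (geq_minl, geq_minr).
have [_ [_ _ _ _ uw]] := bag_lt_witness bu us.
have [_ [_ _ _ _ vw]] := bag_lt_witness bv vs.
by apply: e_trans (e_le (geq_minl _ _) uw) (e_sym (e_le (geq_minr _ _) vw)).
Qed.

Lemma aux_forested h' Q : (h <= h')%N -> (forall v, Q v -> P v) ->
  forested dl h' Q (aux_edge h') lv e.
Proof.
move=> hh' QP; split.
- move=> x y [E [xy|[xy [s [w [bx by_ xs ys]]]]]]; split=> //.
    by left; exact: H_sym.
  by right; split; [exact: (dl_sym dlP)|exists s, w].
- move=> x y /QP Px /QP Py [_ [xy|[]//]].
  exact: (dl_le dlP hh' (H_dl Px Py xy)).
- by case: fP.
- by case: fP.
- by move=> x y /QP Px /QP Py; exact: aux_edge_e.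
Qed.

Variables (r k : nat).
Hypothesis packP : forall d w, pack dl r k.+1 (bag d w).

Definition far v := P v /\ ~ del (T + r) v.

(** An extra edge comes from a bag deeper than both ends, so [v] has an [H]-neighbour at that depth
    in the same subtree and already lies in the original bag at depth [d]. *)
Lemma aux_bag h' d w v : tree_bag far (aux_edge h') lv e d w v ->
  [/\ bag d w v, ev v = era d w & ~ near (T + r) (era d w) w v].
Proof.
move=> [[Pv fv] vd [v' [[Pv' _] vv' dv' v'w]]].
suff [bv E evw] : [/\ bag d w v, ev v = ev v' & e (lv v) v w].
  have evw' : ev v = era d w.
    rewrite E -(era_e v'w); apply/esym/era_convex => //.
    by rewrite -/(ev v') -E (leq_trans (era_le _ _) vd).
  split=> //; rewrite -evw' => nv; apply: fv.
  by apply: near_e nv; exact/e_sym/(e_le _ evw)/era_le.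
case: vv' => [v'v|[E vv']].
  subst v'; split=> //; last exact: e_le v'w.
  by split=> //; exists v; split=> //; left.
have evw : e (lv v) v w.
  have /aux_edge_e := conj E vv'; move=> /(_ Pv Pv').
  rewrite (minn_idPl (leq_trans vd dv')) => vv'e.
  exact: e_trans vv'e (e_le vd v'w).
split=> //; case: vv' => [vv'|[_ [s [w' [bv bv' vs v's]]]]].
  by split=> //; exists v'; split=> //; right.
have [a [Pa va sa aw' _]] := bag_lt_witness bv vs.
have [b [Pb v'b sb bw' _]] := bag_lt_witness bv' v's.
have ds : (d <= s)%N := leq_trans dv' (ltnW v's).
split=> //; exists a; split=> //; [by right|exact: leq_trans ds sa|].
apply: e_trans (e_le ds (e_trans aw' (e_sym bw'))) _.
apply: e_trans v'w; apply/e_sym/(e_le dv')/H_e => //.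
exact: leq_trans (ltnW v's) sb.
Qed.

(** While an era lasts, a point [x] of the bag is within [T] of the opening bag, so the [r]-ball
    around [x] contains no far point of the bag: one ball is saved. The opening bag itself has no
    far points. *)
Lemma aux_pack h' d w : pack dl r k (tree_bag far (aux_edge h') lv e d w).
Proof.
have none : era d w = d -> pack dl r k (tree_bag far (aux_edge h') lv e d w).
  move=> dd; apply: (pack_sub (S' := fun=> False)); last by case: (k) => [|k'] x [].
  move=> v /aux_bag [bv _]; rewrite dd; apply.
  by exists v => //; exact: (dl0 dlP).
case: d none => [|d] none; first exact: none.
have := erefl (era d.+1 w); rewrite [in RHS]/=; case: asboolP => [|_ /none //].
move=> [x bx nx] E; apply: pack_sub (packP bx) => v /aux_bag [bv _ nv].
split=> // vx; apply: nv; rewrite E; apply: near_trans (leqnn _) nx _.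
exact: (dl_sym dlP).
Qed.

End Eras.

(* Induction on [k].  In every era, the points within [h] of the bag at its start
   get one colour, those in the surrounding ring the other one, and the
   remaining points are coloured by induction: as long as the era lasts, one of
   the [k + 1] balls covering the current bag is close to the starting bag, so
   [k] balls cover the points of the bag beyond the ring. *)
Theorem tree_two_coloring k r h : exists R, forall V (dl : nat -> V -> V -> Prop),
  is_ndist dl -> forall P H lv e, forested dl h P H lv e ->
  (forall d w, pack dl r k (tree_bag P H lv e d w)) ->
  exists X : V -> Prop,
    bounded dl H (fun v => P v /\ X v) R /\ bounded dl H (fun v => P v /\ ~ X v) R.
Proof.
elim: k h => [|k IH] h.
  exists 0%N => V dl dlP P H lv e fP packP; exists (fun=> True).
  have noP v : ~ P v by move=> Pv; exact: packP (bag_self fP Pv).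
  by split=> x y xy; case: (chain_head xy) => /noP.
(* [inn] bounds the inner components, those of the points within [h] of an opening bag; [h'] lets an
   auxiliary edge bypass such a component. *)
pose inn := (k.+1 * ((r + (h + h)) + h))%N.
pose h' := (h + inn + h)%N.
have [R' HR'] := IH h'.
(* With this [T], no edge inside an era joins an inner point to a far one, and no edge to an earlier
   era ends at an inner point. *)
pose T := (h + h)%N.
pose N := (T + r + h + R')%N.
pose outer := (inn + h + R')%N.
exists (R' + k.+1 * ((r + (N + N)) + h) + (outer + outer))%N.
move=> V dl dlP P H lv e fP packP.
have hh' : (h <= h')%N by rewrite /h' -addnA leq_addr.
pose Far := far dl P H lv e T r.
pose Del := del dl P H lv e T.
pose Ev := ev dl P H lv e T.
have [||X [X1 X0]] :=
    HR' V dl dlP Far (aux_edge dl P H lv e T h') lv e.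
- by apply: (aux_forested dlP fP) => // v [].
- by move=> d w; apply: (aux_pack dlP fP).
have innP v : P v -> Del h v -> ~ Far v.
  by move=> _ dv [_]; apply; apply: (del_le dlP) dv; rewrite /T -addnA leq_addr.
pose one v := (~ Far v /\ ~ Del h v) \/ (Far v /\ X v).
have auxE u v : P u -> P v -> Far u -> Far v -> H u v -> Ev u = Ev v ->
    aux_edge dl P H lv e T h' u v by move=> *; split; [|left].
exists one; split.
(* An edge between different eras has its deeper end within [h] of an opening bag, which [one]
   excludes. *)
- have same u v : P u /\ one u -> P v /\ one v -> H u v -> Ev u = Ev v.
    have nin w : P w -> one w -> ~ Del h w.
      by move=> Pw [[]//|[Fw _] dw]; exact: innP dw Fw.
    move=> [Pu ou] [Pv ov] uv.
    case: (edgeVcross fP T Pu Pv uv) => [//|uv'|vu'].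
      by case: (edge_cross dlP fP Pu Pv uv uv') => /nin; case.
    by case: (edge_cross dlP fP Pv Pu (H_sym fP uv) vu') => /nin; case.
  (* Up to its first point off [Far], the chain is a chain of the auxiliary structure inside [X],
     hence of diameter at most [R'], and it ends next to the ring. So all points of the component
     are within [N] of the opening bag. *)
  have toring v z : chain H (fun v => P v /\ one v) v z ->
      [/\ Ev v = Ev z, e (Ev v) v z &
      ~ Far z -> ~ Far v \/ exists2 u,
        chain (aux_edge dl P H lv e T h') (fun v => Far v /\ X v) v u &
        Del (T + r + h)%N u].
    elim=> [a oa|a b c oa ab bc [E ee IHc]].
      by split=> //; [exact: (e_refl fP)|left].
    have ob := chain_head bc; have Eab := same _ _ oa ob ab.
    split; [by rewrite Eab| |].
      apply: (e_trans fP (same_e fP oa.1 ob.1 ab Eab)).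
      by rewrite -/(Ev a) Eab.
    move=> /IHc Fb; have [Fa|nFa] := pselect (Far a); last by left.
    right; have Xa : X a by case: oa.2 => [[]//|[]].
    case: Fb => [nFb|[u bu du]]; last first.
      exists u => //; apply: (chain_cons _ _ bu) => //.
      by apply: auxE => //; [exact: oa.1|exact: ob.1|exact: (chain_head bu).1].
    exists a; first exact: chain_nil.
    apply: (edge_del dlP fP ob.1 oa.1 (H_sym fP ab) (esym Eab)).
    by apply: contrapT => nd; apply: nFb; split=> //; exact: ob.1.
  move=> x y xy.
  have [[z [xz nFz]]|allFar] := pselect (exists z,
      chain H (fun v => P v /\ one v) x z /\ ~ Far z); last first.
    apply: (dl_le dlP _ (X1 _ _ _)); first by rewrite -addnA leq_addr.
    apply: chain_mono (chain_reach xy) => [u [[Pu ou] xu]|u v [ou xu] [ov xv] uv].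
    have Fu : Far u by apply: contrapT => nF; apply: allFar; exists u.
    by split=> //; case: ou => [[]//|[]].
    apply: auxE; [exact: ou.1|exact: ov.1| | |exact: uv|exact: same].
      by apply: contrapT => nF; apply: allFar; exists u.
    by apply: contrapT => nF; apply: allFar; exists v.
  have nearz v : chain H (fun v => P v /\ one v) x v ->
      near dl P H lv e N (Ev x) x v.
    move=> xv; have [Exv exv _] := toring _ _ xv.
    have vz : chain H (fun v => P v /\ one v) v z.
      by apply: chain_trans xz; apply: chain_sym xv; exact: (H_sym fP).
    have [_ _ /(_ nFz) dv] := toring _ _ vz.
    suff dN : Del N v.
      by move: dN; rewrite /Del /del -/(Ev v) -Exv; apply: (near_e fP (e_sym fP exv)).
    have Pv := (chain_last xv).1.
    case: dv => [nF|[u vu du]].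
      have : Del (T + r)%N v by apply: contrapT => nd; apply: nF.
      by apply: (del_le dlP); rewrite /N -addnA leq_addr.
    have Euv : Ev u = Ev v /\ e (Ev v) v u.
      elim: vu {du xv vz nFz Exv exv Pv} => [a _|a b c [Fa _] ab bc [Ecb ebc]].
        by split=> //; exact: (e_refl fP).
      have Eab : Ev a = Ev b := ab.1.
      split; first by rewrite Eab.
      have := aux_edge_e fP Fa.1 (chain_head bc).1.1 ab.
      move=> eab; apply: (e_trans fP _ (y := b)); last by rewrite Eab.
      apply: (e_le fP) eab; rewrite leq_min; apply/andP; split; first exact: era_le.
      by rewrite Eab; exact: era_le.
    have /(dl_sym dlP) uv := X1 _ _ vu.
    rewrite /Del /del -/(Ev v) -Euv.1.
    apply: (near_trans dlP (leqnn _) _ uv).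
    apply: (near_e fP _ du); rewrite -/(Ev u) Euv.1; exact/(e_sym fP)/Euv.2.
  have pk := pack_nbhd dlP N (packP (Ev x) x).
  apply: (dl_le dlP (leq_trans (leq_addl R' _) (leq_addr _ _))).
  apply: (pack_chain dlP _ _ pk (chain_reach xy)).
    by move=> u v [[Pu _] _] [[Pv _] _]; exact: (H_dl fP).
  by move=> v [_ /nearz].
- have cls v : P v /\ ~ one v -> Del h v \/ Far v /\ ~ X v.
    move=> [Pv nov]; have [dv|nd] := pselect (Del h v); [by left|right].
    have Fv : Far v by apply: contrapT => nF; apply: nov; left.
    by split=> // Xv; apply: nov; right.
  have nfar u v : P u -> P v -> H u v -> Ev u = Ev v -> Del h u -> ~ Far v.
    move=> Pu Pv uv E du [_]; apply.
    by apply: (del_le dlP _ (edge_del dlP fP Pu Pv uv E du)); exact: leq_addr.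
  have ninT v : Del h v -> Del T v by apply: (del_le dlP); exact: leq_addr.
  pose ich := chain H (fun v => P v /\ Del h v).
  have isame u v : P u /\ Del h u -> P v /\ Del h v -> H u v -> Ev u = Ev v.
    move=> [Pu du] [Pv dv] uv; case: (edgeVcross fP T Pu Pv uv) => [//|uv'|vu'].
      by case: (edge_cross dlP fP Pu Pv uv uv') => _ [] /=; exact: ninT.
    by case: (edge_cross dlP fP Pv Pu (H_sym fP uv) vu') => _ []; exact: ninT.
  have ichE x y : ich x y -> Ev x = Ev y /\ e (Ev x) x y.
    elim=> [a|a b c ia ab bc [E eb]]; first by split=> //; exact: (e_refl fP).
    have ib := chain_head bc; have Eab := isame _ _ ia ib ab.
    split; first by rewrite Eab.
    apply: (e_trans fP (same_e fP ia.1 ib.1 ab Eab)).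
    by rewrite -/(Ev a) Eab.
  have ich_dl x y : ich x y -> dl inn x y.
    move=> xy; apply: (pack_chain dlP _ _ (pack_nbhd dlP h (packP (Ev x) x))
      (chain_reach xy)).
      by move=> u v [[Pu _] _] [[Pv _] _]; exact: (H_dl fP).
    move=> v [[_ dv] /ichE [E exv]].
    by move: dv; rewrite /Del /del -/(Ev v) -E; apply: (near_e fP (e_sym fP exv)).
  pose och := chain (aux_edge dl P H lv e T h') (fun v => Far v /\ ~ X v).
  (* A chain of this colour may pass through inner components. Edges between far and inner points
     change era, so both far points around such a passage lie in the bag opening the era of the
     component, and an auxiliary edge joins them. Only an initial inner piece can remain. *)
  have toout x y : chain H (fun v => P v /\ ~ one v) x y -> Far y ->
      och x y \/ exists v u, [/\ ich x v, H v u, (lv u < Ev v)%N, P u & och u y].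
    elim=> [a oa Fa|a b c oa ab bc IHc /IHc {}IHc].
      left; apply: chain_nil; split=> //.
      by case: (cls _ oa) => [ia|[]//]; case: (innP _ oa.1 ia).
    have [ob Pa] := (chain_head bc, oa.1); have Pb := ob.1.
    case: (cls _ oa) => [ia|[Fa Xa]]; last first.
      left; case: IHc => [bc'|[v [u [bv vu lu Pu uc]]]].
        apply: (chain_cons _ _ bc') => //; have [Fb _] := chain_head bc'.
        apply: auxE => //.
        case: (edgeVcross fP T Pa Pb ab) => [//|l|l].
          by case: (edge_cross dlP fP Pa Pb ab l) => /innP; case.
        by case: (edge_cross dlP fP Pb Pa (H_sym fP ab) l) => /innP; case.
      have [_ ib] := chain_head bv; have [Pv _] := chain_last bv.
      have [Ebv ebv] := ichE _ _ bv.
      case: (edgeVcross fP T Pa Pb ab) => [E|l|l].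
      - by case: (nfar b a Pb Pa (H_sym fP ab) (esym E) ib Fa).
      - have [_ _ evA] := edge_cross dlP fP Pa Pb ab l.
        have [_ _ evU] := edge_cross dlP fP Pu Pv (H_sym fP vu) lu.
        have EVb : (Ev b <= lv b)%N by exact: era_le.
        have EVv : (Ev v <= lv v)%N by exact: era_le.
        apply: (chain_cons _ _ uc) => //; split.
          rewrite evA evU -/(Ev v) -/(Ev b) -Ebv; apply: (era_e fP).
          by apply: (e_le fP) ebv; exact: leq_pred.
        right; split.
          apply: (dl_trans dlP (leqnn _) (dl_trans dlP (leqnn _) _ (ich_dl _ _ bv))).
            exact: (H_dl fP Pa Pb ab).
          exact: (H_dl fP Pv Pu vu).
        exists (Ev b), b; split=> //; last by rewrite Ebv.
          by apply: (edge_bag fP) => //; exact: ltnW.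
        apply: (bag_e fP (e_sym fP ebv)); rewrite Ebv.
        apply: (edge_bag fP) => //; first exact: (H_sym fP).
        exact: ltnW.
      - case: (edge_cross dlP fP Pb Pa (H_sym fP ab) l) => da _ _.
        by case: (innP _ Pa da Fa).
    right; case: IHc => [bc'|[v [u [bv vu lu Pu uc]]]]; last first.
      by exists v, u; split=> //; apply: (chain_cons _ _ bv).
    exists a, b; split=> //; first exact: chain_nil.
    have [Fb _] := chain_head bc'.
    case: (edgeVcross fP T Pa Pb ab) => [E|l|//]; first by case: (nfar a b Pa Pb ab E ia Fb).
    by case: (edge_cross dlP fP Pa Pb ab l) => /innP; case.
  have toout_dl x y : chain H (fun v => P v /\ ~ one v) x y -> Far y ->
      dl outer x y.
    move=> xy Fy; case: (toout _ _ xy Fy) => [/X0|[v [u [xv vu _ Pu /X0 uy]]]].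
      by apply: (dl_le dlP); exact: leq_addl.
    have := H_dl fP (chain_last xv).1 Pu vu.
    move=> /(dl_trans dlP (leqnn _) (ich_dl _ _ xv)) xu.
    exact: (dl_trans dlP (leqnn _) xu uy).
  move=> x y xy.
  have [[z [xz Fz]]|noFar] := pselect (exists z,
      chain H (fun v => P v /\ ~ one v) x z /\ Far z).
    have yz : chain H (fun v => P v /\ ~ one v) y z.
      by apply: chain_trans xz; apply: chain_sym xy; exact: (H_sym fP).
    apply: (dl_trans dlP _ (toout_dl _ _ xz Fz) (dl_sym dlP (toout_dl _ _ yz Fz))).
    exact: leq_addl.
  apply: (dl_le dlP _ (ich_dl _ _ _)).
    apply: leq_trans (leq_addl _ (outer + outer)).
by apply: (@leq_trans outer); rewrite ?leq_addl // /outer -addnA leq_addr.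
  apply: chain_mono (chain_reach xy) => // u [ou xu].
  split; first exact: ou.1.
  by case: (cls _ ou) => [//|[Fu _]]; case: noFar; exists u.
Qed.

(* The colour class [Y] can be made to avoid any prescribed set [F] with bounded
   components: apply the previous theorem after gluing to every point the
   components of [F] next to it. *)
Section Gluing.
Variables (V : Type) (dl : nat -> V -> V -> Prop).
Hypothesis dlP : is_ndist dl.
Variables (h : nat) (P : V -> Prop) (H : V -> V -> Prop) (lv : V -> nat)
  (e : nat -> V -> V -> Prop).
Hypothesis fP : forested dl h P H lv e.
Variables (F : V -> Prop) (RF : nat).
Hypothesis FP : forall v, F v -> P v.
Hypothesis bF : bounded dl H F RF.

(** Steps start only at [v] or in [F]: this collects [v], its neighbours, the components of [F] next
    to it, and the neighbours of these. *)
Inductive glue (v : V) : V -> Prop :=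
| glue_nil : glue v v
| glue_cons x y : glue v x -> x = v \/ F x -> H x y -> P y -> glue v y.

Lemma glue_P v w : P v -> glue v w -> P w.
Proof. by move=> Pv [|]. Qed.

Lemma glue_dl v w : P v -> glue v w -> dl (RF + (h + h)) v w.
Proof.
move=> Pv vw.
suff [E|[Hvw|[f [g [vf fg gw]]]]] : w = v \/ H v w \/
    exists f g, [/\ H v f, chain H F f g & H g w].
- by rewrite E; exact: (dl0 dlP).
- apply: (dl_le dlP _ (H_dl fP Pv (glue_P Pv vw) Hvw)).
  by lia.
- have [Ff Fg] := (FP (chain_head fg), FP (chain_last fg)).
  apply: (dl_trans dlP _ (dl_trans dlP (leqnn _) (H_dl fP Pv Ff vf) (bF fg))
    (H_dl fP Fg (glue_P Pv vw) gw)).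
  by lia.
elim: vw => [|x y _ IH xF xy Py]; first by left.
right; case: xF => [E|Fx]; first by left; rewrite -E.
case: IH => [E|[vx|[f [g [vf fg gx]]]]].
- by left; rewrite -E.
- by right; exists x, x; split=> //; exact: chain_nil.
- right; exists f, x; split=> //; apply: (chain_trans fg).
  exact: chain_cons (chain_last fg) gx (chain_nil _ Fx).
Qed.

Lemma glue_top v : exists2 g, glue v g & forall w, glue v w -> (lv g <= lv w)%N.
Proof.
suff H0 m w : glue v w -> (lv w <= m)%N ->
    exists2 g, glue v g & forall w, glue v w -> (lv g <= lv w)%N.
  exact: H0 (glue_nil v) (leqnn _).
elim: m w => [|m IH] w vw wm.
  by exists w => // w' _; move: wm; rewrite leqn0 => /eqP->.
have [[w' [vw' w'm]]|nw] := pselect (exists w', glue v w' /\ (lv w' <= m)%N).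
  exact: IH vw' w'm.
exists w => // w' vw'; apply: leq_trans wm _.
by rewrite ltnNge; apply/negP => w'm; apply: nw; exists w'.
Qed.

(** The glued set is connected, so it lies in the subtree of its shallowest point; the new structure
    places [v] at that node. *)
Definition top v := sval (cid2 (glue_top v)).
Definition lvt v := lv (top v).

Lemma top_glue v : glue v (top v).
Proof. by rewrite /top; case: cid2. Qed.

Lemma lvt_le v w : glue v w -> (lvt v <= lv w)%N.
Proof. by rewrite /lvt /top; case: cid2 => /= g _ ; apply. Qed.

Lemma glue_e v w : P v -> glue v w -> e (lvt v) v w.
Proof.
move=> Pv; elim=> [|x y vx vx' xF xy Py]; first exact: (e_refl fP).
apply: (e_trans fP vx' (H_e fP (glue_P Pv vx) Py xy _ _)); apply: lvt_le => //.
exact: glue_cons vx xF xy Py.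
Qed.

Definition glue_edge u v := exists2 w, glue u w & glue v w.

Lemma glue_edge_adj u v : P v -> H u v -> glue_edge u v.
Proof.
move=> Pv uv; exists v; last exact: glue_nil.
by apply: glue_cons (glue_nil u) _ uv Pv; left.
Qed.

Lemma glue_forested :
  forested dl ((RF + (h + h)) + (RF + (h + h))) P glue_edge lvt e.
Proof.
split.
- by move=> x y [w xw yw]; exists w.
- move=> x y Px Py [w xw yw].
  exact: (dl_trans dlP (leqnn _) (glue_dl Px xw) (dl_sym dlP (glue_dl Py yw))).
- by case: fP.
- by case: fP.
- move=> x y Px Py [w xw yw].
  apply: (e_trans fP (e_le fP (geq_minl _ _) (glue_e Px xw))).
  exact/(e_sym fP)/(e_le fP (geq_minr _ _))/glue_e.
Qed.

(** On the way from [v] to [g], the first point at depth at most [d] is in the bag: its predecessor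
    is deeper and in the same subtree. *)
Lemma glue_bag_down d w v g : P v -> e d v w -> (d <= lv v)%N -> glue v g ->
  (lv g <= d)%N -> exists2 b, glue v b & tree_bag P H lv e d w b.
Proof.
move=> Pv vw dv; suff H0 x : glue v x ->
    (exists2 b, glue v b & tree_bag P H lv e d w b) \/ (d < lv x)%N /\ e d x w.
  by move=> vg gd; case: (H0 _ vg) => // -[dg _]; rewrite leqNgt dg in gd.
elim=> [|a b va IH aF ab Pb].
  move: dv; rewrite leq_eqVlt => /predU1P[dE|dv]; last by right.
  left; exists v; first exact: glue_nil.
  split=> //; first by rewrite dE.
  by exists v; split=> //; [left|rewrite dE].
case: IH => [|[da aw]]; first by left.
have vb := glue_cons va aF ab Pb; have Pa := glue_P Pv va.
have [bd|db] := leqP (lv b) d.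
  left; exists b => //; split=> //; exists a; split=> //; last exact: ltnW.
  by right; exact: (H_sym fP).
right; split=> //; apply: (e_trans fP _ aw).
by apply/(e_sym fP)/(H_e fP) => //; exact: ltnW.
Qed.

Lemma glue_bag_up d w v u : P v -> glue v u -> (d <= lv u)%N -> e d u w ->
  (exists2 b, glue v b & tree_bag P H lv e d w b) \/ (d <= lv v)%N /\ e d v w.
Proof.
move=> Pv; elim=> [dv vw|a b va IH aF ab Pb db bw]; first by right.
have Pa := glue_P Pv va.
have [da|ad] := leqP d (lv a).
  by apply: (IH da); apply: (e_trans fP _ bw); exact: (H_e fP).
left; exists a => //; split=> //; first exact: ltnW.
by exists b; split=> //; right.
Qed.

Lemma glue_bag d w v : tree_bag P glue_edge lvt e d w v ->
  exists2 b, glue v b & tree_bag P H lv e d w b.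
Proof.
move=> [Pv vd [v' [Pv' vv' dv' v'w]]].
have [u vu [du uw]] : exists2 u, glue v u & (d <= lv u)%N /\ e d u w.
  case: vv' => [E|[u vu v'u]].
    exists v; first exact: glue_nil.
    by rewrite -E; split=> //; apply: leq_trans dv' _; exact/lvt_le/glue_nil.
  exists u => //; split; first exact: leq_trans dv' (lvt_le v'u).
  exact: (e_trans fP (e_sym fP (e_le fP dv' (glue_e Pv' v'u))) v'w).
case: (glue_bag_up Pv vu du uw) => [//|[dlv vw]].
exact: (glue_bag_down Pv vw dlv (top_glue v) vd).
Qed.

Lemma glue_pack r k : (forall d w, pack dl r k (tree_bag P H lv e d w)) ->
  forall d w, pack dl (r + ((RF + (h + h)) + (RF + (h + h)))) k
    (tree_bag P glue_edge lvt e d w).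
Proof.
move=> pk d w; apply: pack_sub (pack_nbhd dlP (RF + (h + h)) (pk d w)).
move=> v bv; have [b vb bb] := glue_bag bv.
by exists b => //; apply/(dl_sym dlP)/glue_dl => //; case: bv.
Qed.

(** A run through [F] between two points off [F] becomes a single glued edge. So a chain in the
    complement is, after an initial run in [F] of diameter at most [RF], a glued chain off [X]. *)
Lemma glue_free_bounded R (X : V -> Prop) :
  bounded dl glue_edge (fun v => P v /\ X v) R ->
  bounded dl glue_edge (fun v => P v /\ ~ X v) R ->
  bounded dl H (fun v => P v /\ (X v /\ ~ F v)) ((RF + h + R) + (RF + h + R)) /\
  bounded dl H (fun v => P v /\ ~ (X v /\ ~ F v)) ((RF + h + R) + (RF + h + R)).
Proof.
move=> bX bnX; split=> x y xy.
  apply: (dl_le dlP (leq_trans (leq_addl _ _) (leq_addr _ _))); apply: bX.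
  apply: chain_mono xy => [u [Pu []]//|u v _ [Pv _] uv].
  exact: glue_edge_adj.
pose S v := P v /\ ~ (X v /\ ~ F v).
have SnX v : S v -> ~ F v -> P v /\ ~ X v.
  by move=> [Pv nX] nF; split=> // Xv; apply: nX.
pose C := chain glue_edge (fun v => P v /\ ~ X v).
have key z o : chain H S z o -> ~ F o ->
    (~ F z /\ C z o) \/ exists f g, [/\ chain H F z f, H f g & C g o].
  elim=> [a Sa nFa|a b c Sa ab bc IH /IH{}IH].
    by left; split=> //; apply: chain_nil; exact: SnX.
  have [Fa|nFa] := pselect (F a).
    right; case: IH => [[_ bc']|[f [g [bf fg gc]]]].
      by exists a, b; split=> //; exact: chain_nil.
    by exists f, g; split=> //; exact: chain_cons Fa ab bf.
  left; split=> //; case: IH => [[nFb bc']|[f [g [bf fg gc]]]].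
    apply: chain_cons bc'; first exact: SnX.
    exact: glue_edge_adj (chain_head bc).1 ab.
  apply: (chain_cons _ _ gc); first exact: SnX.
  exists g; last exact: glue_nil.
  have af : glue a f.
    have ab' : glue a b.
      by apply: glue_cons (glue_nil a) _ ab (chain_head bc).1; left.
    elim: bf ab' {fg gc} => // u v w Fu uv vw IHv au.
    by apply: IHv; apply: glue_cons au _ uv (FP (chain_head vw)); right.
  by apply: glue_cons af _ fg (chain_head gc).1; right; exact: chain_last bf.
have key_dl z o : chain H S z o -> ~ F o -> dl (RF + h + R) z o.
  move=> zo /(key _ _ zo) [[_ /bnX]|[f [g [zf fg gy]]]].
    by apply: (dl_le dlP); exact: leq_addl.
  have gh := H_dl fP (FP (chain_last zf)) (chain_head gy).1 fg.
  by apply: (dl_trans dlP (leqnn _) (dl_trans dlP (leqnn _) (bF zf) gh)); exact: bnX.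
have [[z [xz nFz]]|allF] := pselect (exists z, chain H S x z /\ ~ F z).
  have yz : chain H S y z.
    by apply: chain_trans xz; apply: chain_sym xy; exact: (H_sym fP).
  exact: (dl_trans dlP (leqnn _) (key_dl _ _ xz nFz) (dl_sym dlP (key_dl _ _ yz nFz))).
apply: (dl_le dlP _ (bF _)); first by lia.
apply: chain_mono (chain_reach xy) => // u [_ xu].
by apply: contrapT => nF; apply: allF; exists u.
Qed.

End Gluing.

Theorem tree_two_coloring_avoiding k r h RF : exists R,
  forall V (dl : nat -> V -> V -> Prop), is_ndist dl ->
  forall P H lv e, forested dl h P H lv e ->
  (forall d w, pack dl r k (tree_bag P H lv e d w)) ->
  forall F : V -> Prop, (forall v, F v -> P v) -> bounded dl H F RF ->
  exists Y : V -> Prop, [/\ forall v, Y v -> P v /\ ~ F v,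
    bounded dl H Y R & bounded dl H (fun v => P v /\ ~ Y v) R].
Proof.
pose p := (RF + (h + h) + (RF + (h + h)))%N.
have [R HR] := tree_two_coloring k (r + p) p.
exists ((RF + h + R) + (RF + h + R))%N => V dl dlP P H lv e fP pk F FP bF.
have [X [X1 X0]] := HR _ _ dlP _ _ _ _ (glue_forested dlP fP FP bF)
  (glue_pack dlP fP FP bF pk).
have [Y1 Y0] := glue_free_bounded dlP fP FP bF X1 X0.
exists (fun v => P v /\ (X v /\ ~ F v)); split=> // [v [Pv [_ nF]]//|x y xy].
apply: Y0; apply: chain_sub xy => v [Pv nY]; split=> // XF; exact: nY.
Qed.

(* Later sets are kept at distance more than their scale from the earlier ones;
   this keeps the components of the union bounded, at a decreasing sequence of
   scales. *)
Lemma disjoint_separators q rho r k : exists R,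
  forall V (dl : nat -> V -> V -> Prop), is_ndist dl ->
  forall (P : nat -> V -> Prop) (lv : nat -> V -> nat)
    (e : nat -> nat -> V -> V -> Prop),
  (forall a h, (a < q)%N -> (h <= 3 ^ q * rho)%N ->
     forested dl h (P a) (dl h) (lv a) (e a) /\
     forall d w, pack dl r k (tree_bag (P a) (dl h) (lv a) (e a) d w)) ->
  exists Y : nat -> V -> Prop,
    (forall a, (a < q)%N -> bounded dl (dl rho) (fun v => P a v /\ ~ Y a v) R) /\
    (forall a b v, (a < b < q)%N -> Y a v -> ~ Y b v).
Proof.
(* The union of the first [b] sets is kept bounded at scale [3 ^ (q - b) * rho], so that each
   further set may divide the scale by three. *)
suff main : forall b, (b <= q)%N -> exists R,
  forall V (dl : nat -> V -> V -> Prop), is_ndist dl ->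
  forall (P : nat -> V -> Prop) (lv : nat -> V -> nat)
    (e : nat -> nat -> V -> V -> Prop),
  (forall a h, (a < q)%N -> (h <= 3 ^ q * rho)%N ->
     forested dl h (P a) (dl h) (lv a) (e a) /\
     forall d w, pack dl r k (tree_bag (P a) (dl h) (lv a) (e a) d w)) ->
  exists Y : nat -> V -> Prop,
    [/\ forall a, (a < b)%N -> bounded dl (dl rho) (fun v => P a v /\ ~ Y a v) R,
        forall a a' v, (a < a' < b)%N -> Y a v -> ~ Y a' v &
        bounded dl (dl (3 ^ (q - b) * rho)) (fun v => exists2 a, (a < b)%N & Y a v) R].
- have [R HR] := main q (leqnn q).
  exists R => V dl dlP P lv e Hq.
  by have [Y [Y1 Y2 _]] := HR V dl dlP P lv e Hq; exists Y.
elim=> [_|b IH bq].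
  exists 0%N => V dl dlP P lv e Hq; exists (fun _ _ => False).
  by split=> // x y xy; case: (chain_head xy).
have [R HR] := IH (ltnW bq).
pose g := (3 ^ (q - b.+1) * rho)%N.
have g3 : (3 ^ (q - b) * rho = 3 * g)%N.
  by rewrite /g -(@subnSK b) // expnS mulnA.
have gq : (g <= 3 ^ q * rho)%N by rewrite leq_mul2r leq_exp2l // leq_subr orbT.
have rg : (rho <= g)%N by rewrite leq_pmull // expn_gt0.
have [R' HR'] := tree_two_coloring_avoiding k r g (R + (g + g)).
exists (R + R')%N => V dl dlP P lv e Hq.
have [Y [Y1 Y2 Y3]] := HR V dl dlP P lv e Hq.
have [fb pb] := Hq b g bq gq.
pose U v := exists2 a, (a < b)%N & Y a v.
(* The new set must avoid the [g]-neighbourhood of the earlier ones. A [g]-chain in [F] is shadowed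
   by a chain of [U] with steps at most [3 * g], hence is bounded. *)
pose F v := P b v /\ exists2 u, U u & dl g v u.
have bF : bounded dl (dl g) F (R + (g + g)).
  move=> x y xy.
  have [_ [x' Ux' xx']] := chain_head xy.
  suff [y' [yy' x'y']] : exists y', dl g y y' /\ chain (dl (3 ^ (q - b) * rho)) U x' y'.
    have := dl_trans dlP (leqnn _) xx' (Y3 _ _ x'y').
    move=> /(dl_trans dlP) xy'; apply: (xy' _ _ _ _ (dl_sym dlP yy')).
    by lia.
  elim: xy x' Ux' xx' => [u Fu|u v w Fu uv vw IHw] x' Ux' xx'.
    by exists x'; split=> //; exact: chain_nil.
  have [_ [v' Uv' vv']] := chain_head vw.
  have [y' [wy' v'y']] := IHw _ Uv' vv'.
  exists y'; split=> //; apply: (chain_cons Ux' _ v'y').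
  apply: (dl_trans dlP _ (dl_trans dlP (leqnn _) (dl_sym dlP xx') uv) vv').
  by rewrite g3; lia.
have [Z [ZP Z1 Z0]] := HR' V dl dlP _ _ _ _ fb pb F (fun v => @proj1 _ _) bF.
exists (fun a => if (a < b)%N then Y a else Z); split.
- move=> a; rewrite ltnS leq_eqVlt => /predU1P[->|ab].
    rewrite ltnn => x y xy; apply: (dl_le dlP (leq_addl R R')); apply: Z0.
    by apply: chain_mono xy => // u v _ _; exact: (dl_le dlP).
  by rewrite ab => x y /(Y1 _ ab) /(dl_le dlP); apply; exact: leq_addr.
- move=> a a' v /andP[aa']; rewrite ltnS leq_eqVlt => /predU1P[a'b|a'b].
    rewrite a'b ltnn -a'b aa' => Yv /ZP [Pv]; apply; split=> //.
    by exists v; [exists a => //; rewrite -a'b|exact: (dl0 dlP)].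
  by rewrite a'b (ltn_trans aa' a'b); apply: Y2; rewrite aa'.
- have cls v : (exists2 a, (a < b.+1)%N & (if (a < b)%N then Y a else Z) v) ->
      U v \/ Z v.
    by move=> [a _]; case: ifP => [ab Yv|_ Zv]; [left; exists a|right].
  move=> x y xy.
  have {}xy : chain (dl g) (fun v => U v \/ Z v) x y by apply: chain_mono xy => //.
  suff [c|c] : chain (dl g) U x y \/ chain (dl g) Z x y.
  + apply: (dl_le dlP (leq_addr _ _)); apply: Y3; apply: chain_mono c => // u v _ _.
    by apply: (dl_le dlP); rewrite g3; lia.
  + by apply: (dl_le dlP (leq_addl _ _)); exact: Z1.
  have sep u v : U u -> Z v -> ~ dl g v u.
    by move=> Uu /ZP [Pv nF] vu; apply: nF; split=> //; exists u.
  elim: xy => [u [Uu|Zu]|u v w uUZ uv _ [c|c]].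
  + by left; exact: chain_nil.
  + by right; exact: chain_nil.
  + left; case: uUZ => [Uu|Zu]; first exact: chain_cons c.
    by case: (sep _ _ (chain_head c) Zu).
  + right; case: uUZ => [Uu|Zu]; last exact: chain_cons c.
    by case: (sep _ _ Uu (chain_head c)); exact: (dl_sym dlP).
Qed.

(** * Nested shifted grids *)

Import Order.TTheory GRing.Theory Num.Theory.
Import numFieldNormedType.Exports.
Local Open Scope classical_set_scope.
Local Open Scope ring_scope.

Section Grids.
Variable R : realType.

Lemma floor_ltW (X Y : R) : Num.floor X <= Num.floor Y ->
  Num.floor X <> Num.floor Y -> exists j : int, X <= j%:~R <= Y.
Proof.
move=> XY neq; exists (Num.floor Y); rewrite Num.Theory.floor_le andbT.
have : (Num.floor X < Num.floor Y)%R by rewrite lt_neqAle XY andbT; exact/eqP.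
by rewrite floor_lt_int => /ltW.
Qed.

Lemma floor_neq_near (X Y eps : R) : `|Y - X| <= eps ->
  Num.floor Y <> Num.floor X -> exists j : int, `|X - j%:~R| <= eps.
Proof.
move=> XY neq; have [le|/ltW le] := leP (Num.floor Y) (Num.floor X).
  have [j /andP[Yj jX]] := floor_ltW le neq.
  by exists j; move: XY; rewrite !ler_norml; lra.
have [j /andP[Yj jX]] := floor_ltW le (nesym neq).
by exists j; move: XY; rewrite !ler_norml; lra.
Qed.

(** Comparing an integer with the left side amounts to comparing another integer with the floor of
    [Y]. *)
Lemma floor_divB (Y Z : R) (a : int) (B : nat) : (0 < B)%N ->
  Num.floor Y = Num.floor Z ->
  Num.floor ((Y - a%:~R) / B%:R) = Num.floor ((Z - a%:~R) / B%:R).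
Proof.
move=> B0; have B0' : 0 < B%:R :> R by rewrite ltr0n.
suff H (j : int) (W : R) : (j <= Num.floor ((W - a%:~R) / B%:R)) =
    (j * B%:Z + a <= Num.floor W).
  by move=> YZ; apply/le_anti; rewrite H -YZ -H lexx H YZ -H lexx.
by rewrite !floor_ge_int ler_pdivlMr // lerBrDr intrD intrM -pmulrn.
Qed.

(* Cells of mesh [L] shifted by [a L / q].  Since [(q + 1) a / q = a + a / q],
   the grids of mesh [L] and [(q + 1) L] with the same [a] are nested. *)
Definition grid (q a : nat) (L y : R) : int := Num.floor (y / L - a%:R / q%:R).

Lemma grid_coarse q a L y z : (0 < q)%N -> 0 < L ->
  grid q a L y = grid q a L z -> grid q a (q.+1%:R * L) y = grid q a (q.+1%:R * L) z.
Proof.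
move=> q0 L0 /(@floor_divB _ _ a%:Z _ (ltn0Sn q)); rewrite /grid.
have q0' : q%:R != 0 :> R by rewrite pnatr_eq0 -lt0n.
have E w : (w / L - a%:R / q%:R - a%:Z%:~R) / q.+1%:R =
    w / (q.+1%:R * L) - a%:R / q%:R.
  rewrite -pmulrn -natr1; field.
  by rewrite q0' gt_eqF //= natr1 pnatr_eq0.
by rewrite !E.
Qed.

Lemma grid_near q a L y z : 0 < L -> grid q a L y = grid q a L z -> `|y - z| <= L.
Proof.
rewrite /grid => L0 E; set t := a%:R / q%:R in E.
have := floor_itv (y / L - t); have := floor_itv (z / L - t); rewrite E => Hz Hy.
have : `|y / L - z / L| <= 1 by rewrite ler_norml; lra.
rewrite -mulrBl normrM normfV (gtr0_norm L0) ler_pdivrMr //.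
by rewrite mul1r.
Qed.

(** Walls of two different grids are at least [L / q] apart, so [x] cannot be within [eps] of
    both. *)
Lemma grid_bad_uniq q a a' (L eps x y y' : R) : 0 < L -> (a < q)%N -> (a' < q)%N ->
  2 * eps * q%:R < L -> `|y - x| <= eps -> `|y' - x| <= eps ->
  grid q a L y <> grid q a L x -> grid q a' L y' <> grid q a' L x -> a = a'.
Proof.
move=> L0 aq a'q epsL yx y'x bad bad'.
have q0 : 0 < q%:R :> R by rewrite ltr0n (leq_trans _ aq).
have near b w : `|w - x| <= eps -> `|w / L - b%:R / q%:R - (x / L - b%:R / q%:R)| <= eps / L.
  move=> wx; have -> : w / L - b%:R / q%:R - (x / L - b%:R / q%:R) = (w - x) / L by ring.
  by rewrite normrM normfV (gtr0_norm L0) ler_pM2r // invr_gt0.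
have [j Hj] := floor_neq_near (near a y yx) bad.
have [j' Hj'] := floor_neq_near (near a' y' y'x) bad'.
have eL : 2 * (eps / L) < q%:R^-1.
  by rewrite mulrA ltr_pdivrMr // [_ * L]mulrC ltr_pdivlMr.
(* An integer of absolute value below 1 vanishes; then [q] divides [a' - a], which forces
   equality. *)
have : `|(a'%:Z - a%:Z - q%:Z * (j - j'))%:~R : R| < 1.
  have -> : (a'%:Z - a%:Z - q%:Z * (j - j'))%:~R =
     q%:R * ((x / L - a%:R / q%:R - j%:~R) - (x / L - a'%:R / q%:R - j'%:~R)) :> R.
    rewrite !(intrD, intrM, rmorphN) /= -!pmulrn; field.
    by rewrite !gt_eqF.
  rewrite normrM (gtr0_norm q0) mulrC -ltr_pdivlMr // mul1r.
  by apply: le_lt_trans eL; move: Hj Hj'; rewrite !ler_norml; lra.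
rewrite -intr_norm -[1]/(1%:~R) ltr_int => H.
have {H} : a'%:Z - a%:Z = q%:Z * (j - j') by lia.
move: (j - j') => t Ht; have [t0|[t1|t1]] : t = 0 \/ 1 <= t \/ t <= -1 by lia.
- by rewrite t0 in Ht; lia.
- have : q%:Z <= q%:Z * t by rewrite ler_peMr.
  by lia.
- have : q%:Z * t <= - q%:Z by rewrite -lerN2 opprK -mulrN ler_peMr // lerNr.
  by lia.
Qed.

End Grids.

(** * Finite families of fat sets *)

Section Walks.
Variables (T I : Type) (A : I -> set T).

Definition touch u v := A u `&` A v !=set0.

Fixpoint walk (m : nat) (u v : I) : Prop :=
  if m is m'.+1 then walk m' u v \/ exists2 w, walk m' u w & touch w v else u = v.

Lemma walk_refl m u : walk m u u.
Proof. by elim: m => //= m IH; left. Qed.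

Lemma walk_leS m m' u v : (m <= m')%N -> walk m u v -> walk m' u v.
Proof.
elim: m' => [|m' IH]; first by rewrite leqn0 => /eqP->.
by rewrite leq_eqVlt => /predU1P[->//|]; rewrite ltnS => mm' /(IH mm'); left.
Qed.

Lemma walk1 u v : touch u v -> walk 1 u v.
Proof. by right; exists u. Qed.

Lemma walk_cat m m' u v w : walk m u v -> walk m' v w -> walk (m + m') u w.
Proof.
move=> uv; elim: m' w => [|m' IH] w /=; first by rewrite addn0 => <-.
rewrite addnS => -[/IH|[x /IH ux xw]]; first by left.
by right; exists x.
Qed.

Lemma walk_sym m u v : walk m u v -> walk m v u.
Proof.
elim: m v => [|m IH] v /=; first by move->.
case=> [/IH|[w /IH wu wv]]; first by left.
have : walk (1 + m) v u; last by [].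
by apply: walk_cat wu; apply: walk1; rewrite /touch setIC.
Qed.

Lemma walk_ndist : is_ndist walk.
Proof.
split; [exact: walk_refl|exact: walk_sym|exact: walk_leS|exact: walk_cat].
Qed.

End Walks.

(** Pigeonhole: deleting the [r]-ball around a point deletes all points sharing its code. *)
Lemma pack_code V (dl : nat -> V -> V -> Prop) r (C : finType)
    (code : V -> C -> Prop) (S : V -> Prop) :
  (forall v, S v -> exists c, code v c) ->
  (forall u v c, S u -> S v -> code u c -> code v c -> dl r u v) ->
  pack dl r #|C| S.
Proof.
move=> tot inj.
suff H k (D : {set C}) S' : (forall v, S' v -> S v) ->
    (forall v, S' v -> exists2 c, c \in D & code v c) -> #|D| = k -> pack dl r k S'.
  apply: (H _ [set: C]%SET S) => //; last exact: cardsT.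
  by move=> v /tot[c vc]; exists c; rewrite ?inE.
elim: k D S' => [|k IH] D S' sub DS Dk.
  by move=> v /DS[c]; rewrite (cards0_eq Dk) inE.
move=> x S'x; have [c cD xc] := DS _ S'x.
apply: (IH (D :\ c)%SET).
- by move=> v [/sub].
- move=> v [S'v nvx]; have [c' c'D vc'] := DS _ S'v.
  exists c' => //; rewrite !inE c'D andbT; apply/eqP => E; apply: nvx.
  by apply: (inj _ _ c) => //; [exact: sub|exact: sub|rewrite -E].
- by move: Dk; rewrite (cardsD1 c) cD => -[].
Qed.

(* [D] is the size of [S], and [S] meets the lattice of mesh [s / N] close to
   each of its points, for every [s] up to its size. *)
Definition fat (R : realType) (n N : nat) (S : set 'rV[R]_n) (D : R) : Prop :=
  [/\ 0 < D, S !=set0, forall x y i, S x -> S y -> `|x 0 i - y 0 i| <= D &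
   forall x s, S x -> 0 < s -> s <= D -> exists (g : 'I_n -> int) (y : 'rV[R]_n),
     S y /\ forall i, y 0 i = s / N%:R * (g i)%:~R /\ `|x 0 i - y 0 i| <= s].

(** * Scales, cells and lucky members of a finite fat family *)

Section FatFamily.
Variables (R : realType) (n N : nat) (V : finType) (A : V -> set 'rV[R]_n)
  (D : V -> R).
Hypothesis N0 : (0 < N)%N.
Hypothesis fatA : forall v, fat N (A v) (D v).
Variables (s0 : R) (sigma c0 : nat).
Hypotheses (s00 : 0 < s0) (s0D : forall v, s0 <= D v).

Let q := n.+2.
Let B := q.+1.
Let K := sigma.+1.
(** Cells [c0] levels above a scale are more than [2 * K * q] times larger, so the points within [K]
    times the scale of a given point cross walls of at most one of the [q] grids in each
    coordinate. *)
Hypothesis c0K : (2 * K * q < B ^ c0)%N.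

Let sc k : R := s0 * (B ^ k)%:R.

Lemma sc_gt0 k : 0 < sc k.
Proof. by rewrite mulr_gt0 // ltr0n expn_gt0. Qed.

Lemma scS k : sc k.+1 = B%:R * sc k.
Proof. by rewrite /sc expnS natrM mulrCA. Qed.

Lemma sc_le k l : (k <= l)%N -> sc k <= sc l.
Proof. by move=> kl; rewrite ler_pM2l // ler_nat leq_exp2l. Qed.

Lemma scD k l : sc (k + l) = sc k * (B ^ l)%:R.
Proof. by rewrite /sc expnD natrM mulrA. Qed.

Lemma ex_lev v : exists k, D v <= sc k.
Proof.
exists (Num.trunc (D v / s0)).+1.
have D0 : 0 <= D v / s0 by case: (fatA v) => /ltW D0 *; exact: divr_ge0 D0 (ltW s00).
rewrite /sc mulrC -ler_pdivrMr //; apply: le_trans (ltW (truncnS_gt _)) _.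
by rewrite ler_nat; apply: ltnW; apply: ltn_expl.
Qed.

Definition lev v := ex_minn (ex_lev v).

Lemma D_le v : D v <= sc (lev v).
Proof. by rewrite /lev; case: ex_minnP. Qed.

Lemma D_ge v : sc (lev v) <= B%:R * D v.
Proof.
rewrite /lev; case: ex_minnP => -[|k] _ mn.
  rewrite /sc expn0 mulr1; apply: le_trans (s0D v) _.
  by rewrite ler_peMl ?ler1n //; case: (fatA v) => /ltW.
rewrite scS ler_pM2l ?ltr0n // leNgt; apply/negP => /ltW/mn.
by rewrite ltnn.
Qed.

Let w_ m u v := walk A m u v.

Lemma ex_pt v : exists x, A v x. Proof. by case: (fatA v). Qed.
Definition pt v := sval (cid (ex_pt v)).
Lemma ptP v : A v (pt v). Proof. by rewrite /pt; case: cid. Qed.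

Lemma A_diam k v x y i : A v x -> A v y -> (lev v <= k)%N -> `|x 0 i - y 0 i| <= sc k.
Proof.
move=> Ax Ay vk; case: (fatA v) => _ _ dA _.
exact: le_trans (dA _ _ i Ax Ay) (le_trans (D_le v) (sc_le vk)).
Qed.

Lemma walk_near k m u v : (forall w, w_ m u w -> (lev w <= k)%N) -> w_ m u v ->
  forall p i, A v p -> `|pt u 0 i - p 0 i| <= m.+1%:R * sc k.
Proof.
elim: m v => [|m IH] v small.
  move=> /= <- p i Ap; rewrite mul1r.
  by apply: A_diam Ap _; [exact: ptP|apply: small; exact: walk_refl].
have IH' := IH _ (fun w uw => small w (or_introl uw)).
move=> /= vu p i Ap.
case: (vu) => [uv|[w uw [z [Awz Avz]]]].
  apply: le_trans (IH' _ uv p i Ap) _.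
  by rewrite ler_wpM2r ?ler_nat // ltW // sc_gt0.
have h1 := IH' _ uw z i Awz.
have h2 := A_diam i Avz Ap (small _ vu).
apply: le_trans (ler_distD (z 0 i) _ _) _.
by rewrite -[m.+2%:R]natr1 mulrDl mul1r lerD.
Qed.

(** Stop at the first member of level at least [k]: the earlier ones have size at most [sc k], so it
    is still reached close to [pt u]. *)
Lemma walk_first_big k m u z : w_ m u z ->
  (exists y p, [/\ (k <= lev y)%N, A y p, w_ m u y &
     forall i, `|pt u 0 i - p 0 i| <= m.+1%:R * sc k]) \/
  ((lev z < k)%N /\ forall p i, A z p -> `|pt u 0 i - p 0 i| <= m.+1%:R * sc k).
Proof.
have sc0 l : 0 <= l%:R * sc k by rewrite mulr_ge0 // ltW // sc_gt0.
have mono l (x : R) : x <= l.+1%:R * sc k -> x <= l.+2%:R * sc k.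
  by move=> h; apply: le_trans h _; rewrite ler_wpM2r ?ler_nat // ltW // sc_gt0.
elim: m z => [|m IH] z.
  move=> /= <-; have [ku|uk] := leqP k (lev u).
    left; exists u, (pt u); split=> //; first exact: ptP.
    by move=> i; rewrite subrr normr0.
  right; split=> // p i Ap; rewrite mul1r.
  by apply: A_diam Ap (ltnW uk); exact: ptP.
have lift : (exists y p, [/\ (k <= lev y)%N, A y p, w_ m u y &
     forall i, `|pt u 0 i - p 0 i| <= m.+1%:R * sc k]) ->
   (exists y p, [/\ (k <= lev y)%N, A y p, w_ m.+1 u y &
     forall i, `|pt u 0 i - p 0 i| <= m.+2%:R * sc k]).
  by move=> [y [p [ky Ap uy H]]]; exists y, p; split=> //; [left|move=> i; exact: mono].
move=> uz; case: (uz) => [/IH[/lift big|[zk H]]|[w /IH[/lift big|[wk H]] [t [Awt Azt]]]];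
  [by left| |by left|].
  by right; split=> // p i /H h; exact: mono.
have [kz|zk] := leqP k (lev z).
  by left; exists z, t; split=> // i; apply: mono; exact: H.
right; split=> // p i Ap.
apply: le_trans (ler_distD (t 0 i) _ _) _.
by rewrite -[m.+2%:R]natr1 mulrDl mul1r lerD // ?H //; exact: A_diam (ltnW zk).
Qed.

(* Walks of length at most [sigma] from [v] only use members of level at most
   [mlev v], so they stay close to [v] at that scale. *)
Definition mlev v := \max_(w | `[< w_ sigma v w >]) lev w.

Lemma mlev_ge v w m : (m <= sigma)%N -> w_ m v w -> (lev w <= mlev v)%N.
Proof. by move=> ms vw; apply: leq_bigmax_cond; apply/asboolP; exact: walk_leS ms vw. Qed.

Lemma mlev_wit v : exists2 w, w_ sigma v w & lev w = mlev v.
Proof.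
have [|w wP E] := @eq_bigmax_cond _ [pred w | `[< w_ sigma v w >]] lev.
  by apply/card_gt0P; exists v; apply/asboolP; exact: walk_refl.
by exists w; [exact/asboolP|rewrite /mlev E].
Qed.

Let top := \max_v mlev v.
Definition depth v := (top - mlev v)%N.

Lemma mlev_top v : (mlev v <= top)%N. Proof. exact: leq_bigmax. Qed.

Definition samecell a d u v := forall i,
  grid q a (sc (top - d + c0)) (pt u 0 i) = grid q a (sc (top - d + c0)) (pt v 0 i).

(** Lucky members sit deep inside a cell at the scale of their surroundings; [K] leaves room for
    walks of length [sigma]. *)
Definition lucky a v := forall i y, `|y - pt v 0 i| <= K%:R * sc (mlev v) ->
  grid q a (sc (mlev v + c0)) y = grid q a (sc (mlev v + c0)) (pt v 0 i).

Lemma lucky_same a h u v : (h <= sigma)%N -> lucky a u -> w_ h u v ->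
  forall i, grid q a (sc (mlev u + c0)) (pt v 0 i) = grid q a (sc (mlev u + c0)) (pt u 0 i).
Proof.
move=> hs lu uv i; apply: lu; rewrite distrC.
apply: le_trans (walk_near (k := mlev u) _ uv i (ptP v)) _.
  by move=> w; exact: mlev_ge.
by rewrite ler_wpM2r ?ler_nat // ltW // sc_gt0.
Qed.

(** Of two neighbours, the one with the larger [mlev] is nearer the root and, being lucky, has the
    other in its cell. *)
Lemma grid_forested a h : (h <= sigma)%N ->
  forested w_ h (lucky a) (w_ h) depth (samecell a).
Proof.
move=> hs; split=> //.
- by move=> x y; exact: walk_sym.
- move=> d; split=> // [x y xy i|x y z xy yz i]; first by rewrite xy.
  by rewrite xy yz.
(* Beyond depth [top] the truncated subtraction stays at 0 and the cells no longer change. *)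
- move=> d x y xy i; have := xy i; rewrite subnS.
  case: (top - d)%N => //= l E.
  by rewrite addSn scS; apply: grid_coarse => //; exact: sc_gt0.
- move=> x y lx ly xy i.
  wlog le_yx : x y lx ly xy / (mlev y <= mlev x)%N.
    move=> W; have [?|/ltnW le] := leqP (mlev y) (mlev x); first exact: W.
    by rewrite minnC; apply/esym/W => //; exact: walk_sym.
  have -> : minn (depth x) (depth y) = depth x by rewrite (minn_idPl _) // leq_sub2l.
  by rewrite subKn ?mlev_top //; apply/esym/(lucky_same hs lx xy).
Qed.

(** In units of [sc k], a cell has side [B ^ c0], and a walk of length [2 * sigma] with the lattice
    approximation adds less than [2 * sigma + 3]; the factor [B * N] converts to mesh steps. *)
Let Q := (B * N * (B ^ c0 + sigma.*2 + 3))%N.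

(** Each [v] in the bag is within [3 * sigma] of a member [y] of level at least [k] passing near the
    cell; fatness gives a lattice point in [y], which serves as code. Equal codes give touching
    members, hence [6 * sigma + 1]. *)
Lemma grid_pack a h d w : (h <= sigma)%N ->
  pack w_ (6 * sigma + 1) #|{ffun 'I_n -> 'I_(2 * Q + 2)}|
    (tree_bag (lucky a) (w_ h) depth (samecell a) d w).
Proof.
move=> hs; pose k := (top - d)%N; pose mesh := sc k / B%:R / N%:R.
have B0 : 0 < B%:R :> R by rewrite ltr0n.
have N0' : 0 < N%:R :> R by rewrite ltr0n.
have mesh0 : 0 < mesh by rewrite !divr_gt0 // sc_gt0.
pose f i : int := Num.floor (pt w 0 i / mesh).
pose code v (t : {ffun 'I_n -> 'I_(2 * Q + 2)}) := exists y p,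
  [/\ w_ (3 * sigma) v y, A y p &
      forall i, p 0 i = mesh * (f i - Q%:Z + (t i : nat)%:Z)%:~R].
apply: (pack_code (code := code)) => [v|u v t _ _]; last first.
  move=> [y [p [uy Ayp py]]] [y' [p' [vy' Ay'p' p'y']]].
  have pp' : p = p' by apply/rowP => i; rewrite py p'y'.
  have yy' : w_ 1 y y' by apply: walk1; exists p; split=> //; rewrite pp'.
  apply: walk_leS (walk_cat (walk_cat uy yy') (walk_sym vy')); lia.
move=> [lv vd [v' [lv' vv' dv' v'w]]].
have dtop : (d <= top)%N by apply: leq_trans dv' _; exact: leq_subr.
have kv : (k <= mlev v)%N by move: vd; rewrite /depth /k; lia.
have {}vv' : w_ sigma v' v.
  by apply: walk_leS hs _; apply: walk_sym; case: vv' => [->|//]; exact: walk_refl.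
have [z vz zk] := mlev_wit v.
have [[y [p [ky Ayp v'y pn]]]|[]] := walk_first_big k (walk_cat vv' vz); last first.
  by rewrite zk ltnNge kv.
have [_ _ _ /(_ p (sc k / B%:R) Ayp)] := fatA y.
have sD : sc k / B%:R <= D y.
  by rewrite ler_pdivrMr // mulrC; apply: le_trans (sc_le ky) (D_ge y).
move=> /(_ (divr_gt0 (sc_gt0 _) B0) sD) [g [p' [Ayp' gp']]].
have bnd i : f i - Q%:Z <= g i <= f i + Q%:Z + 1.
  have [p'E pp'] := gp' i.
  have h1 := grid_near (sc_gt0 _) (v'w i); have h2 := pn i.
  have h3 : sc k / B%:R <= sc k.
    by rewrite ler_pdivrMr // ler_peMr ?ler1n // ltW // sc_gt0.
  have : `|p' 0 i - pt w 0 i| <= sc k * (B ^ c0 + sigma.*2 + 2)%:R.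
    move: h1; rewrite -/k scD.
    rewrite !natrD; move: h2; rewrite addnn -[_.*2.+1%:R]natr1.
    by move: pp'; rewrite !ler_norml; nra.
  have scE : sc k * (B ^ c0 + sigma.*2 + 2)%:R <= mesh * Q%:R.
    have -> : mesh * Q%:R = sc k * (B ^ c0 + sigma.*2 + 3)%:R.
      by rewrite /mesh /Q !natrM; field; rewrite !gt_eqF.
    by rewrite ler_pM2l ?sc_gt0 // ler_nat leq_add2l.
  move=> /le_trans /(_ scE); rewrite p'E -/mesh => Hm.
  have Hg : `|(g i)%:~R - pt w 0 i / mesh| <= Q%:R.
    rewrite -(ler_pM2l mesh0) -{1}(gtr0_norm mesh0) -normrM mulrBr.
    by rewrite (mulrC mesh (_ / _)) divfK ?gt_eqF.
  have := floor_itv (pt w 0 i / mesh); rewrite -/(f i) intrD => Hf.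
  rewrite -!(ler_int R) !intrD intrN -!pmulrn.
  by move: Hf Hg; rewrite !ler_norml; lra.
have tlt i : (absz (g i - f i + Q%:Z)%R < 2 * Q + 2)%N by move: (bnd i); lia.
exists [ffun i => Ordinal (tlt i)], y, p'; split=> //.
  by apply: walk_leS (walk_cat (walk_sym vv') v'y); lia.
move=> i; have [-> _] := gp' i; rewrite -/mesh; congr (_ * _%:~R).
by rewrite ffunE /=; move: (bnd i); lia.
Qed.

(** Each of the [n] coordinates spoils at most one of the [n + 2] grids. *)
Lemma two_lucky v : exists a b, [/\ (a < b)%N, (b < q)%N, lucky a v & lucky b v].
Proof.
pose G : {set 'I_q} := [set a : 'I_q | `[< lucky a v >]]%SET.
pose bad (a : 'I_q) i := exists2 y, `|y - pt v 0 i| <= K%:R * sc (mlev v) &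
  grid q a (sc (mlev v + c0)) y <> grid q a (sc (mlev v + c0)) (pt v 0 i).
have badE (a : 'I_q) : a \notin G -> exists i, bad a i.
  rewrite inE => /asboolPn nl; apply: contrapT => nb; apply: nl => i y yi.
  by apply: contrapT => neq; apply: nb; exists i, y.
have bad_uniq (a b : 'I_q) i : bad a i -> bad b i -> a = b.
  move=> [y yi ya] [z zi zb]; apply/val_inj.
  apply: (grid_bad_uniq (sc_gt0 _) (ltn_ord a) (ltn_ord b) _ yi zi ya zb).
  rewrite scD mulrA mulrAC [_ * sc _]mulrC ltr_pM2l ?sc_gt0 //.
  by rewrite -!natrM ltr_nat.
have Gc : (#|~: G| <= n)%N.
  have [->|[a0]] := set_0Vmem (~: G)%SET; first by rewrite cards0.
  rewrite finset.in_setC => /badE[i0 _].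
  pose c (a : 'I_q) := if pselect (exists i, bad a i) is left p then sval (cid p) else i0.
  have cP (a : 'I_q) : a \notin G -> bad a (c a).
    by move=> /badE ba; rewrite /c; case: pselect => // p; case: cid.
  rewrite -[X in (_ <= X)%N]card_ord -(@card_in_imset _ _ c); first exact: max_card.
  move=> a b; rewrite !finset.in_setC => /cP ba /cP bb E.
  by apply: bad_uniq ba _; rewrite E.
have : (1 < #|G|)%N.
  rewrite -(leq_add2r #|~: G|) cardsC card_ord.
  by apply: leq_trans (_ : 2 + n <= _)%N; rewrite ?leq_add2l.
move=> /card_gt1P [a [b []]]; rewrite !inE => /asboolP/asboolW la /asboolP/asboolW lb ab.
move: ab; rewrite -val_eqE neq_ltn => /orP[ltab|ltba].
- by exists a, b; split=> //; exact: ltn_ord.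
- by exists b, a; split=> //; exact: ltn_ord.
Qed.

End FatFamily.

Theorem fat_family_coloring n N rho : (0 < N)%N -> exists M,
  forall (R : realType) (V : finType) (A : V -> set 'rV[R]_n) (D : V -> R),
  (forall v, fat N (A v) (D v)) ->
  exists c : V -> 'I_n.+2, forall s,
    bounded (walk A) (walk A rho) (fun v => c v = s) M.
Proof.
(* [sigma] is the largest scale at which the separation works. *)
move=> N0; pose q := n.+2; pose sigma := (3 ^ q * rho)%N.
pose c0 := (2 * sigma.+1 * q)%N.
have c0K : (2 * sigma.+1 * q < q.+1 ^ c0)%N by apply: ltn_expl.
pose Q := (q.+1 * N * (q.+1 ^ c0 + sigma.*2 + 3))%N.
have [M HM] := disjoint_separators q rho (6 * sigma + 1) #|{ffun 'I_n -> 'I_(2 * Q + 2)}|.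
exists M => R V A D fatA.
(* Finiteness gives a smallest size, with default 1 for the empty family; the bound [M] is fixed
   beforehand. *)
have [s0 s00 s0D] : exists2 s0 : R, 0 < s0 & forall v, s0 <= D v.
  exists (\big[Num.min/1]_v D v).
    by apply: lt_bigmin => // v _; case: (fatA v).
  by move=> v; exact: bigmin_le.
have [|Y [Y1 Y2]] := HM V (walk A) (walk_ndist A) (lucky fatA sigma c0 s00)
    (fun=> depth fatA sigma s00) (samecell fatA sigma c0 s00).
  move=> a h aq hs; split; first exact: grid_forested.
  by move=> d w; exact: grid_pack.
have ex v : exists a : 'I_q, lucky fatA sigma c0 s00 a v /\ ~ Y a v.
  have [a [b [ab bq la lb]]] := two_lucky fatA s00 c0K v.
  have [Ya|nYa] := pselect (Y a v).
    by exists (Ordinal bq); split=> //; apply: Y2 Ya; rewrite ab.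
  by exists (Ordinal (ltn_trans ab bq)).
exists (fun v => sval (cid (ex v))) => s x y xy.
apply: (Y1 s (ltn_ord s)); apply: chain_sub xy => v <-.
by case: cid.
Qed.

(** * Sets of bounded aspect ratio are fat *)

Section Fatness.
Variables (R : realType) (n : nat) (S : set 'rV[R]_n).

Lemma coord_le_norm (v : 'rV[R]_n) i : `|v 0 i| <= `|v|.
Proof.
rewrite [leRHS]/Num.norm /= mx_normrE.
exact: (le_bigmax _ (fun ij : 'I_1 * 'I_n => `|v ij.1 ij.2|) (0, i)).
Qed.

Lemma dotprodBr (u x y : 'rV[R]_n) : dotprod u (x - y) = dotprod u x - dotprod u y.
Proof. by rewrite /dotprod -sumrB; apply: eq_bigr => i _; rewrite !mxE mulrBr. Qed.

Lemma dotprodZl a (u x : 'rV[R]_n) : dotprod (a *: u) x = a * dotprod u x.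
Proof. by rewrite /dotprod mulr_sumr; apply: eq_bigr => i _; rewrite !mxE mulrA. Qed.

Lemma coord_le_eucl (v : 'rV[R]_n) i : `|v 0 i| <= eucl_norm v.
Proof.
rewrite -sqrtr_sqr; apply: ler_wsqrtr.
rewrite /dotprod (bigD1 i) //= expr2 lerDl; apply: sumr_ge0 => j _.
by rewrite -expr2 sqr_ge0.
Qed.

Lemma eucl_norm_gt0 (u : 'rV[R]_n) : u != 0 -> 0 < eucl_norm u.
Proof.
move=> /rV0Pn [i ui]; apply: lt_le_trans (coord_le_eucl u i).
by rewrite normr_gt0.
Qed.

Lemma eucl_normZ (u : 'rV[R]_n) a : 0 <= a -> eucl_norm (a *: u) = a * eucl_norm u.
Proof.
move=> a0; rewrite /eucl_norm.
have -> : dotprod (a *: u) (a *: u) = a ^+ 2 * dotprod u u.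
  by rewrite /dotprod mulr_sumr; apply: eq_bigr => i _; rewrite !mxE expr2; ring.
by rewrite sqrtrM ?sqr_ge0 // sqrtr_sqr ger0_norm.
Qed.

Lemma eucl_norm_le (v : 'rV[R]_n) a : (forall i, `|v 0 i| <= a) -> 0 <= a ->
  eucl_norm v <= Num.sqrt (n%:R * a ^+ 2).
Proof.
move=> va a0; rewrite /eucl_norm ler_wsqrtr // /dotprod.
apply: le_trans (_ : \sum_(i < n) a ^+ 2 <= _).
  apply: ler_sum => i _; rewrite -expr2 -(real_normK (num_real _)).
  by rewrite ler_pXn2r ?nnegrE.
by rewrite sumr_const card_ord mulr_natl.
Qed.

(** [W] is the height: if [S] varied by less than [W / 3] along a unit vector, a slab of thickness
    [2 W / 3] would contain it. *)
Lemma aspect_ratio_width r : (0 < n)%N -> 1 <= r -> compact S ->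
    aspect_ratio_le r S ->
  exists W : R, [/\ 0 < W, S !=set0,
    forall x y, S x -> S y -> eucl_norm (x - y) <= r * W &
    forall u : 'rV[R]_n, exists x y, [/\ S x, S y &
      W / 3 * eucl_norm u <= dotprod u (x - y)]].
Proof.
move=> n0 r1 cS [hS arS].
have [M [M0 SM]] : exists M : R, 0 < M /\ forall x, S x -> forall i, `|x 0 i| <= M.
  have [M [_ SM]] := compact_bounded cS.
  exists (`|M| + 1); split=> [|x Sx i]; first by rewrite ltr_pwDr.
  apply: le_trans (coord_le_norm _ _) _; apply: SM => //.
  by rewrite (le_lt_trans (ler_norm _)) // ltrDl.
pose e0 : 'rV[R]_n := delta_mx 0 (Ordinal n0).
have de0 x : dotprod e0 x = x 0 (Ordinal n0).
  rewrite /dotprod (bigD1 (Ordinal n0)) //= mxE !eqxx mul1r big1 ?addr0 // => i ni.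
  by rewrite mxE (negbTE ni) andbF mul0r.
have e01 : eucl_norm e0 = 1 by rewrite /eucl_norm de0 mxE !eqxx sqrtr1.
have hle (h : R) : 0 < h -> between_hyperplanes S h -> (height S <= h%:E)%E.
  by move=> h0 bh; apply: ereal_inf_lbound; exists h.
have hM : (height S <= (2 * M)%:E)%E.
  apply: hle; first by rewrite mulr_gt0.
  exists e0, (- M); split=> // x /SM/(_ (Ordinal n0)).
  by rewrite de0 ler_norml; lra.
have [W WE] : exists W : R, height S = W%:E.
  by move: hS hM; case: (height S) => // W; exists W.
have W0 : 0 < W by rewrite -lte_fin -WE.
have nonempty : S !=set0.
  apply: contrapT => /set0P/negP/negPn/eqP S0.
  have : (height S <= (W / 2)%:E)%E.
    apply: hle; first by rewrite divr_gt0.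
    by exists e0, 0; split=> // x; rewrite S0.
  by rewrite WE lee_fin; lra.
exists W; split=> //.
- move=> x y Sx Sy.
  have dle (a b : 'rV[R]_n) : S a -> S b -> ((eucl_norm (a - b))%:E <= diam (@eucl_dist R n) S)%E.
    by move=> Sa Sb; apply: ereal_sup_ubound; exists a => //; exists b.
  have [D DE] : exists D : R, diam (@eucl_dist R n) S = D%:E.
    have := dle _ _ Sx Sy.
    have : (diam (@eucl_dist R n) S <= (Num.sqrt (n%:R * (2 * M) ^+ 2))%:E)%E.
      apply: ge_ereal_sup => _ [a Sa [b Sb <-]]; rewrite lee_fin.
      apply: eucl_norm_le; last by rewrite mulr_ge0 // ltW.
      by move=> i; have := SM _ Sa i; have := SM _ Sb i; rewrite !mxE !ler_norml; lra.
    by case: (diam _ S) => // D; exists D.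
  have := dle _ _ Sx Sy; rewrite DE lee_fin => /le_trans; apply.
  move: arS; rewrite /aspect_ratio DE WE inver gt_eqF // -EFinM lee_fin.
  by rewrite ler_pdivrMr.
- move=> u; have [x0 Sx0] := nonempty.
  have [->|u0] := eqVneq u 0.
    exists x0, x0; split=> //; rewrite subrr.
    have z : dotprod (0 : 'rV[R]_n) 0 = 0.
      by rewrite /dotprod big1 // => i _; rewrite mxE mul0r.
    by rewrite /eucl_norm z sqrtr0 mulr0.
  have un := eucl_norm_gt0 u0.
  apply: contrapT => nw.
  have small x y : S x -> S y -> dotprod u (x - y) < W / 3 * eucl_norm u.
    by move=> Sx Sy; rewrite ltNge; apply/negP => h; apply: nw; exists x, y.
  have : (height S <= (2 * (W / 3))%:E)%E.
    apply: hle; first by rewrite mulr_gt0 ?divr_gt0.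
    exists ((eucl_norm u)^-1 *: u), (dotprod ((eucl_norm u)^-1 *: u) x0 - W / 3).
    split; first by rewrite eucl_normZ ?invr_ge0 ?ltW // mulVf ?gt_eqF.
    move=> x Sx; have := small _ _ Sx Sx0; have := small _ _ Sx0 Sx.
    rewrite !dotprodBr -!ltr_pdivrMr // !dotprodZl !mulrBl ![_ / eucl_norm u]mulrC.
    by move=> h1 h2; apply/andP; split; lra.
  by rewrite WE lee_fin; lra.
Qed.

End Fatness.

(** * Large simplices and boxes inside a wide convex set *)

Section Simplex.
Variables (R : realType) (n : nat) (S : set 'rV[R]_n).

Lemma convex_segment x y (l : R) : convex_set S -> S x -> S y -> 0 <= l -> l <= 1 ->
  S (l *: x + (1 - l) *: y).
Proof.
move=> cS Sx Sy l0 l1.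
by have := cS x y (Itv01 l0 l1) (mem_set Sx) (mem_set Sy); rewrite inE.
Qed.

Lemma convex_simplex (x0 : 'rV[R]_n) k (M : 'M[R]_(k, n)) (t : 'rV[R]_k) :
  convex_set S -> S x0 -> (forall j, S (x0 + row j M)) ->
  (forall j, 0 <= t 0 j) -> \sum_j t 0 j <= 1 -> S (x0 + t *m M).
Proof.
move=> cS Sx0 SM t0 t1.
suff H (s : seq 'I_k) : exists2 c, S (x0 + c) &
    \sum_(j <- s) t 0 j *: row j M = (\sum_(j <- s) t 0 j) *: c.
  have [c Sc E] := H (index_enum _).
  have -> : x0 + t *m M = (\sum_j t 0 j) *: (x0 + c) + (1 - \sum_j t 0 j) *: x0.
    rewrite scalerDr scalerBl scale1r -E mulmx_sum_row.
    by rewrite [RHS]addrC addrA subrK.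
  by apply: convex_segment => //; exact: sumr_ge0.
elim: s => [|j s [c Sc E]].
  by exists 0; rewrite ?addr0 // !big_nil scale0r.
rewrite !big_cons; set T := \sum_(i <- s) t 0 i in E *.
have T0 : 0 <= T by apply: sumr_ge0.
have [tT|tT] := eqVneq (t 0 j + T) 0.
  exists c => //; rewrite E tT scale0r.
  have tj : t 0 j = 0 by have := t0 j; lra.
  have -> : T = 0 by lra.
  by rewrite tj !scale0r addr0.
have tT0 : 0 < t 0 j + T by rewrite lt_neqAle eq_sym tT addr_ge0.
exists ((t 0 j / (t 0 j + T)) *: row j M + (1 - t 0 j / (t 0 j + T)) *: c).
  set l := t 0 j / _; have -> : x0 + (l *: row j M + (1 - l) *: c) =
      l *: (x0 + row j M) + (1 - l) *: (x0 + c).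
    by rewrite !scalerDr addrACA -scalerDl [l + _]addrC subrK scale1r.
  apply: convex_segment => //; first by rewrite divr_ge0 // ltW.
  by rewrite ler_pdivrMr // mul1r lerDl.
rewrite scalerDr !scalerA E; congr (_ *: _ + _ *: _).
  by rewrite mulrC divfK.
by field.
Qed.

Variables (x0 : 'rV[R]_n) (W D : R).
Hypotheses (Sx0 : S x0) (W0 : 0 < W).
Hypothesis dS : forall x y, S x -> S y -> eucl_norm (x - y) <= D.
Hypothesis wS : forall u : 'rV[R]_n, exists x y,
  [/\ S x, S y & W / 3 * eucl_norm u <= dotprod u (x - y)].

(** A vector [u] orthogonal to fewer than [n] rows sees positive width, so some point of [S]
    supplies a row outside their span. *)
Lemma ex_basis : exists M : 'M[R]_n, (forall j, S (x0 + row j M)) /\ \det M != 0.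
Proof.
suff H k : (k <= n)%N -> exists M : 'M[R]_(k, n),
    (forall j, S (x0 + row j M)) /\ \rank M = k.
  have [M [SM rM]] := H n (leqnn n); exists M; split=> //.
  by rewrite -unitfE -unitmxE -row_free_unit /row_free rM.
elim: k => [_|k IH kn].
  by exists 0; split=> [[]//|]; apply/eqP; rewrite -leqn0 rank_leq_row.
have [M [SM rM]] := IH (ltnW kn).
have : kermx M^T != 0.
  by rewrite -mxrank_eq0 mxrank_ker mxrank_tr rM subn_eq0 -ltnNge.
move=> /rowV0Pn [u /sub_kermxP uM u0].
have [x [Sx ux]] : exists x, S x /\ dotprod u (x - x0) != 0.
  have [x [y [Sx Sy]]] := wS u.
  have wpos : 0 < W / 3 * eucl_norm u by rewrite mulr_gt0 ?divr_gt0 ?eucl_norm_gt0.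
  move=> /(lt_le_trans wpos) pos.
  have [ux|ux] := eqVneq (dotprod u (x - x0)) 0; last by exists x.
  exists y; split=> //; apply/eqP => uy; move: pos.
  have -> : x - y = (x - x0) - (y - x0) by rewrite opprB addrA subrK.
  by rewrite dotprodBr ux uy subrr ltxx.
have Scol (j : 'I_(1 + k)) : S (x0 + row j (col_mx (x - x0) M)).
  case: (split_ordP j) => i ->; last by rewrite rowKd.
  have -> : row (lshift k i) (col_mx (x - x0) M) = x - x0.
    by rewrite rowKu; apply/rowP => l; rewrite !mxE [i]ord1.
  by rewrite addrC subrK.
have ltM : (M < col_mx (x - x0) M)%MS.
  have := submx_refl (col_mx (x - x0) M); rewrite {1}col_mx_sub => /andP[_ sM].
  rewrite ltmxE sM col_mx_sub; apply/negP => /andP[/submxP[a xa] _].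
  move/eqP: ux; apply.
  have -> : dotprod u (x - x0) = ((x - x0) *m u^T) 0 0.
    by rewrite mxE; apply: eq_bigr => l _; rewrite [u^T _ _]mxE mulrC.
  by rewrite xa -mulmxA -[M]trmxK -trmx_mul uM trmx0 mulmx0 mxE.
exists (col_mx (x - x0) M : 'M[R]_(1 + k, n)); split; first exact: Scol.
by apply/eqP; rewrite eqn_leq rank_leq_row -{1}rM; exact: rank_ltmx.
Qed.

(** The determinants are bounded since [S] is; a value above half the supremum suffices, without a
    maximum. *)
Lemma ex_maxdet : exists M : 'M[R]_n, [/\ forall j, S (x0 + row j M), \det M != 0 &
  forall M' : 'M[R]_n, (forall j, S (x0 + row j M')) -> `|\det M'| <= 2 * `|\det M|].
Proof.
pose E : set R := fun e => exists2 M : 'M[R]_n,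
  forall j, S (x0 + row j M) & `|\det M| = e.
have [M0 [SM0 dM0]] := ex_basis.
have EM0 : E `|\det M0| by exists M0.
have supE : has_sup E.
  split; first by exists `|\det M0|.
  exists (\sum_(s : 'S_n) \prod_(i < n) D) => _ [M SM <-].
  rewrite /determinant; apply: le_trans (ler_norm_sum _ _ _) _.
  apply: ler_sum => s _; rewrite normrM normr_sign mul1r normr_prod.
  apply: ler_prod => i _; rewrite normr_ge0 /=.
  have := coord_le_eucl (x0 + row i M - x0) (s i).
  rewrite addrC addKr mxE => /le_trans; apply.
  by rewrite -[row i M](addKr x0) addrC; exact: dS.
have s0 : 0 < sup E.
  by apply: lt_le_trans (ub_le_sup supE.2 EM0); rewrite normr_gt0.
have [_ [M SM <-] sM] := sup_adherent (divr_gt0 s0 (ltr0n R 2)) supE.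
exists M; split=> //; first by rewrite -normr_gt0; lra.
move=> M' SM'; have : `|\det M'| <= sup E by apply: (ub_le_sup supE.2); exists M'.
lra.
Qed.

(* The coordinates in a simplex of nearly maximal volume are at most [2] in
   absolute value on [S] (Cramer's rule), so the lower bound on the width of [S]
   bounds the coordinate functionals. *)
Lemma dual_basis : exists M U : 'M[R]_n, [/\ forall j, S (x0 + row j M), U *m M = 1%:M &
  forall i j, `|U i j| <= 12 / W].
Proof.
have [M [SM dM maxM]] := ex_maxdet; exists M, (invmx M).
have uM : M \in unitmx by rewrite unitmxE unitfE.
split=> //; first exact: mulVmx.
move=> i j; pose u : 'rV[R]_n := \row_k invmx M k j.
have coord x : S x -> `|dotprod u (x - x0)| <= 2.
  move=> Sx; pose M' : 'M[R]_n := \matrix_(a, b) (if a == j then (x - x0) 0 b else M a b).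
  have : `|\det M'| <= 2 * `|\det M|.
    apply: maxM => a; have [->|aj] := eqVneq a j.
      have -> : row j M' = x - x0 by apply/rowP => b; rewrite !mxE eqxx.
      by rewrite addrC subrK.
    rewrite (_ : row a M' = row a M) //.
    by apply/rowP => b; rewrite !mxE (negbTE aj).
  have -> : \det M' = \det M * dotprod u (x - x0).
    rewrite (expand_det_row M' j) /dotprod mulr_sumr; apply: eq_bigr => b _.
    have -> : cofactor M' j b = cofactor M j b.
      rewrite /cofactor; congr (_ * \det _); apply/matrixP => a c.
      by rewrite !mxE eq_sym (negbTE (neq_lift _ _)).
    have -> : u 0 b = (\det M)^-1 * cofactor M j b by rewrite mxE /invmx uM !mxE.
    by rewrite [M' j b]mxE eqxx; field.
  by rewrite normrM mulrC ler_pM2r // normr_gt0.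
have [x [y [Sx Sy wxy]]] := wS u.
(* On [S - x0] the functional [u] stays in [-2, 2], so it varies by at most 4; whence the constant
   12. *)
have : W / 3 * eucl_norm u <= 4.
  apply: le_trans wxy _.
  have -> : x - y = (x - x0) - (y - x0) by rewrite opprB addrA subrK.
  rewrite dotprodBr; have := coord _ Sx; have := coord _ Sy; rewrite !ler_norml.
  lra.
have := coord_le_eucl u i; rewrite mxE => /le_trans h nu; apply: h.
rewrite ler_pdivlMr //; lra.
Qed.

(** Take [p] with all weights [1 / (n + 1)] in the simplex. Such a [v] changes each weight by at
    most [1 / (n (n + 1))], so the weights stay nonnegative with sum at most 1. *)
Lemma ex_box : convex_set S -> (0 < n)%N -> exists p, S p /\ forall v : 'rV[R]_n,
  (forall i, `|v 0 i| <= W / (12 * n%:R ^+ 2 * n.+1%:R)) -> S (p + v).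
Proof.
move=> cS n0; have [M [U [SM UM bU]]] := dual_basis.
have n0' : 0 < n%:R :> R by rewrite ltr0n.
have n1' : 0 < n.+1%:R :> R by rewrite ltr0n.
pose t0 : 'rV[R]_n := const_mx n.+1%:R^-1.
have main (v : 'rV[R]_n) : (forall i, `|v 0 i| <= W / (12 * n%:R ^+ 2 * n.+1%:R)) ->
    S (x0 + t0 *m M + v).
  move=> bv; have -> : x0 + t0 *m M + v = x0 + (t0 + v *m U) *m M.
    by rewrite mulmxDl -mulmxA UM mulmx1 addrA.
  have bt j : `|(v *m U) 0 j| <= (n%:R * n.+1%:R)^-1.
    rewrite mxE; apply: le_trans (ler_norm_sum _ _ _) _.
    apply: le_trans (_ : \sum_(k < n) (W / (12 * n%:R ^+ 2 * n.+1%:R)) * (12 / W) <= _).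
      by apply: ler_sum => k _; rewrite normrM ler_pM.
    rewrite sumr_const card_ord -mulr_natl le_eqVlt; apply/orP; left; apply/eqP.
    by field; rewrite !gt_eqF.
  have nn : n.+1%:R^-1 = n%:R * (n%:R * n.+1%:R)^-1 :> R.
    by rewrite invfM mulrA divff ?gt_eqF // mul1r.
  have nn1 : n.+1%:R^-1 >= (n%:R * n.+1%:R)^-1 :> R.
    by rewrite nn ler_peMl ?invr_ge0 ?ler1n // mulr_ge0 ?ltW.
  have tE j : (t0 + v *m U) 0 j = n.+1%:R^-1 + (v *m U) 0 j.
    by rewrite [LHS]mxE [t0 _ _]mxE.
  apply: convex_simplex => // [j|].
    rewrite tE; move: nn1 (bt j); move: (_ * _)^-1 (n.+1%:R^-1 : R) => a b.
    by rewrite ler_norml; lra.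
  apply: le_trans (_ : \sum_(j < n) (n.+1%:R^-1 + (n%:R * n.+1%:R)^-1) <= _).
    by apply: ler_sum => j _; rewrite tE lerD2l; exact: le_trans (ler_norm _) (bt j).
  rewrite sumr_const card_ord -[_ *+ n]mulr_natl mulrDr -nn le_eqVlt; apply/orP; left; apply/eqP.
  by rewrite -natr1; field; rewrite gt_eqF // natr1.
exists (x0 + t0 *m M); split=> //.
rewrite -[_ + _]addr0; apply: main => i; rewrite mxE normr0.
by rewrite divr_ge0 ?mulr_ge0 ?exprn_ge0 ?ltW.
Qed.

End Simplex.

(** Shrinking [S] towards [x] by [l = s / (r W)] keeps it within [s] of [x], and the shrunk box has
    half-side [s / (c r)], which exceeds the mesh since [N > c r]. *)
Lemma aspect_ratio_fat (R : realType) n (r : R) : (0 < n)%N -> 1 <= r ->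
  exists N, (0 < N)%N /\ forall S : set 'rV[R]_n,
    compact S -> convex_set S -> aspect_ratio_le r S -> exists D, fat N S D.
Proof.
move=> n0 r1; pose c : R := 12 * n%:R ^+ 2 * n.+1%:R.
have c0 : 0 < c by rewrite !mulr_gt0 ?exprn_gt0 ?ltr0n.
exists (Num.trunc (c * r)).+1; split=> // S cS vS aS.
set N := _.+1; have N0 : 0 < N%:R :> R by rewrite ltr0n.
have cN : c * r < N%:R by exact: truncnS_gt.
have [W [W0 S0 dS wS]] := aspect_ratio_width n0 r1 cS aS.
have r0 : 0 < r by rewrite (lt_le_trans ltr01).
have D0 : 0 < r * W by rewrite mulr_gt0.
have dSi x y i : S x -> S y -> `|x 0 i - y 0 i| <= r * W.
  move=> Sx Sy; have := coord_le_eucl (x - y) i; rewrite !mxE => /le_trans; apply.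
  exact: dS.
exists (r * W); split=> // x s Sx s0 sD.
have [p [Sp box]] := ex_box Sx W0 dS wS vS n0.
pose l := s / (r * W); have l0 : 0 < l by rewrite divr_gt0.
have l1 : l <= 1 by rewrite ler_pdivrMr // mul1r.
have sE : s = l * (r * W) by rewrite divfK ?gt_eqF.
pose mesh := s / N%:R; have mesh0 : 0 < mesh by rewrite divr_gt0.
pose cen : 'rV[R]_n := x + l *: (p - x).
pose g i : int := Num.floor (cen 0 i / mesh).
pose y : 'rV[R]_n := \row_i (mesh * (g i)%:~R).
pose v : 'rV[R]_n := l^-1 *: (y - cen).
have Spv : S (p + v).
  apply: box => i; rewrite !mxE normrM gtr0_norm ?invr_gt0 // ler_pdivrMl //.
  have -> : l * (W / (12 * n%:R ^+ 2 * n.+1%:R)) = s / (c * r).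
    by rewrite sE -/c; field; rewrite !gt_eqF.
  have h1 : `|y 0 i - cen 0 i| <= mesh.
    have := floor_itv (cen 0 i / mesh); rewrite -/(g i) intrD => /andP[ga gb].
    rewrite [y _ _]mxE -(divfK (lt0r_neq0 mesh0) (cen 0 i)) [_ / mesh * mesh]mulrC.
    by rewrite -mulrBr normrM (gtr0_norm mesh0) -[leRHS]mulr1 ler_pM2l // ler_norml; lra.
  move: h1; rewrite !mxE => /le_trans; apply.
  have cr0 : 0 < c * r by exact: mulr_gt0.
  by rewrite /mesh ler_pM2l // lef_pV2 ?posrE //; exact: ltW.
have yE : y = l *: (p + v) + (1 - l) *: x.
  rewrite /v scalerDr scalerA divff ?gt_eqF // scale1r /cen scalerBl scale1r scalerBr.
  by apply/rowP => i; rewrite !mxE; ring.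
exists g, y; split.
  by rewrite yE; apply: convex_segment => //; exact: ltW.
move=> i; split; first by rewrite mxE.
have -> : x 0 i - y 0 i = l * (x 0 i - (p + v) 0 i).
  rewrite {1}yE; move: (p + v) => z; rewrite !mxE; ring.
by rewrite normrM (gtr0_norm l0) sE ler_pM2l //; exact: dSi.
Qed.

(** * Infinite families *)

(** The colouring is the limit along an ultrafilter on finite subfamilies. A chain involves finitely
    many members, so some finite colouring agrees with the limit on all of it. *)
Lemma coloring_compactness (I : Type) (C : finType) (E good : I -> I -> Prop) :
  (forall s : seq I, exists c : I -> C, forall a x y,
     chain E (fun v => c v = a /\ List.In v s) x y -> good x y) ->
  exists c : I -> C, forall a x y, chain E (fun v => c v = a) x y -> good x y.
Proof.
move=> Hfin; have [c Hc] := choice Hfin.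
pose base (t : seq I) := [set s : seq I | forall x, List.In x t -> List.In x s].
have baseF : ProperFilter (filter_from setT base).
  apply: filter_from_proper; last by move=> t _; exists t.
  apply: filter_from_filter; first by exists [::].
  move=> t t' _ _; exists (t ++ t') => // s st.
  by split=> x xt; apply: st; apply/List.in_app_iff; [left|right].
have [U [ultraU baseU]] := ultraFilterLemma baseF.
have lim i : exists a, U [set s | c s i = a].
  apply: contrapT => /forallNP na.
  have : \forall s \near U, forall a, (~` [set s | c s i = a]) s.
    apply: filter_forall => a.
    by case: (in_ultra_setVsetC [set s | c s i = a] ultraU) => // /na.
  by move=> /filter_ex [s Hs]; exact: (Hs (c s i) erefl).
have [col Hcol] := choice lim.
exists col => a x y xy.
have [t Ht] : exists t, \forall s \near U, (forall z, List.In z t -> List.In z s) ->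
    chain E (fun v => c s v = a /\ List.In v s) x y.
  elim: xy => [u ua|u v w ua uv _ [t Ht]].
    exists [:: u]; near=> s => us; apply: chain_nil; split; last by apply: us; left.
    by rewrite -ua; near: s; exact: Hcol.
  exists (u :: t); near=> s => us.
  have us1 : c s u = a by rewrite -ua; near: s; exact: Hcol.
  apply: (chain_cons (conj us1 (us u (or_introl erefl))) uv).
  have : (forall z, List.In z t -> List.In z s) ->
    chain E (fun v => c s v = a /\ List.In v s) v w by near: s; exact: Ht.
  by apply=> z zt; apply: us; right.
have [s [st /(_ st)]] : exists s, (forall z, List.In z t -> List.In z s) /\
   ((forall z, List.In z t -> List.In z s) ->
    chain E (fun v => c s v = a /\ List.In v s) x y).
  have Ut : U (base t) by apply: baseU; exists t.
  by have [s [? ?]] := filter_ex (filterI Ut Ht); exists s.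
exact: Hc.
Unshelve. all: by end_near.
Qed.

(** * From finite subfamilies to the whole family and its graph *)

Section Subfamilies.
Variables (T I : Type) (A : I -> set T).
Hypothesis A0 : forall i, A i !=set0.

Lemma walk_sub V (g : V -> I) m u v : walk (A \o g) m u v -> walk A m (g u) (g v).
Proof.
elim: m v => [|m IH] v /=; first by move->.
by case=> [/IH|[w /IH uw wv]]; [left|right; exists (g w)].
Qed.

(* One extra step: the same member may be enumerated twice by [g]. *)
Lemma walk_support m x y : walk A m x y -> exists l : seq I,
  forall V (g : V -> I), (forall z, List.In z l -> exists v, g v = z) ->
  forall u v, g u = x -> g v = y -> walk (A \o g) m.+1 u v.
Proof.
elim: m y => [|m IH] y.
  move=> /= <-; exists [::] => V g _ u v ux vx; right; exists u => //.
  by have [p Ap] := A0 x; exists p; rewrite /= ux vx.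
move=> [/IH[l Hl]|[w /IH[l Hl] wy]].
  by exists l => V g gl u v ux vy; left; exact: Hl.
exists (w :: l) => V g gl u v ux vy.
have [vw vwE] := gl w (or_introl erefl).
right; exists vw; last by rewrite /touch /= vwE vy.
by apply: Hl => // z zl; apply: gl; right.
Qed.

Lemma ex_tnth (s : seq I) z : List.In z s -> exists i, tnth (in_tuple s) i = z.
Proof.
move=> zs; suff [i [si Hi]] : exists i, (i < size s)%N /\ forall d, nth d s i = z.
  by exists (Ordinal si); rewrite (tnth_nth z) Hi.
elim: s zs => //= a s IH [->|/IH[i [si Hi]]]; first by exists 0%N.
by exists i.+1; split.
Qed.

Lemma finite_to_infinite (C : finType) (c0 : C) rho M :
  (forall (V : finType) (g : V -> I), exists c : V -> C, forall a,
     bounded (walk (A \o g)) (walk (A \o g) rho.+1) (fun v => c v = a) M) ->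
  exists c : I -> C, forall a, bounded (walk A) (walk A rho) (fun v => c v = a) M.
Proof.
move=> Hfin; apply: coloring_compactness => s.
have Hl (xy : I * I) : exists l : seq I, walk A rho xy.1 xy.2 ->
    forall V (g : V -> I), (forall z, List.In z l -> exists v, g v = z) ->
    forall u v, g u = xy.1 -> g v = xy.2 -> walk (A \o g) rho.+1 u v.
  have [/walk_support[l Hl]|nw] := pselect (walk A rho xy.1 xy.2); first by exists l.
  by exists [::].
have [l {}Hl] := choice Hl.
(* Besides [s], the subfamily needs the intermediate members of short walks between members of [s];
   otherwise distances could grow. *)
pose L := s ++ List.flat_map (fun x => List.flat_map (fun y => l (x, y)) s) s.
have [c Hc] := Hfin 'I_(size L) (tnth (in_tuple L)).
have sL x : List.In x s -> exists i, tnth (in_tuple L) i = x.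
  by move=> xs; apply/ex_tnth/List.in_app_iff; left.
pose idx x := if pselect (exists i, tnth (in_tuple L) i = x) is left p
  then Some (sval (cid p)) else None.
have idxP x : List.In x s -> exists2 i, idx x = Some i & tnth (in_tuple L) i = x.
  move=> /sL p; rewrite /idx; case: pselect => // q; exists (sval (cid q)) => //.
  by case: cid.
exists (fun x => if idx x is Some i then c i else c0) => a x y xy.
suff H u v : chain (walk A rho) (fun v => (if idx v is Some i then c i else c0) = a /\
    List.In v s) u v -> forall i j, idx u = Some i -> idx v = Some j ->
    chain (walk (A \o tnth (in_tuple L)) rho.+1) (fun v => c v = a) i j.
  have [_ /idxP[i xi <-]] := chain_head xy; have [_ /idxP[j yj <-]] := chain_last xy.
  by apply: walk_sub; apply: (Hc a); exact: H xy _ _ xi yj.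
elim=> [{}u [ua _] i j ui|{}u w {}v [ua us] uw wv IH i j ui vj].
  by rewrite ui => -[<-]; apply: chain_nil; rewrite ui in ua.
have [_ ws] := chain_head wv; have [k wk kw] := idxP _ ws.
apply: (chain_cons _ _ (IH _ _ wk vj)); first by rewrite ui in ua.
have [i' ui' iu] := idxP _ us; move: ui'; rewrite ui => -[E]; rewrite -E in iu.
apply: (Hl (u, w) uw) => // z zl; apply/ex_tnth/List.in_app_iff; right.
by apply/List.in_flat_map; exists u; split=> //; apply/List.in_flat_map; exists w.
Qed.

(** If the last vertex is already on the path, the path is cut there, which keeps the vertices
    distinct. *)
Lemma walk_is_path m i j : walk A m i j -> exists k, (k <= m)%N /\
  exists p, @is_path (intersection_graph A) i j k p.
Proof.
elim: m j => [|m IH] j.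
  move=> /= <-; exists 0%N; split=> //; exists (fun=> i); split=> // a b.
  by rewrite !leqn0 => /eqP-> /eqP->.
case=> [/IH[k [km kp]]|[w /IH[k [km [p [p0 pk padj pinj]]]] wj]].
  by exists k; split=> //; exact: leqW.
have [[t [tk pt]]|np] := pselect (exists t, (t <= k)%N /\ p t = j).
  exists t; split; first exact: leq_trans tk (leqW km).
  exists p; split=> // [a at_|a b at_ bt]; first exact/padj/leq_trans/tk.
  by apply: pinj; exact: leq_trans tk.
exists k.+1; split=> //; exists (fun a => if (a <= k)%N then p a else j).
have pj a : (a <= k)%N -> p a <> j by move=> ak paj; apply: np; exists a.
split.
- exact: p0.
- by rewrite ltnn.
- move=> a; rewrite ltnS => ak; rewrite ak; have [ak'|ka] := ltnP a k.
    exact: padj.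
  have -> : a = k by apply/eqP; rewrite eqn_leq ak.
  by rewrite pk; split=> // wj'; apply: (pj k) => //; rewrite pk.
- move=> a b ak1 bk1; have [ak|ka] := leqP a k; have [bk|kb] := leqP b k.
  + exact: pinj.
  + by move=> /(pj _ ak).
  + by move=> /esym/(pj _ bk).
  + by move=> _; apply/eqP; rewrite eqn_leq (leq_trans ak1 kb) (leq_trans bk1 ka).
Qed.

Lemma is_path_walk k i j p : @is_path (intersection_graph A) i j k p -> walk A k i j.
Proof.
move=> [<- <- padj _]; elim: k padj => [//|k IH] padj; right; exists (p k).
  by apply: IH => a ak; apply: padj; exact: leqW.
by have [] := padj k (leqnn _).
Qed.

End Subfamilies.

(** The cover consists of the [rho]-components of the colour classes; two of the same colour at
    distance at most [rho] coincide. *)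
Lemma control_of_coloring (R : realType) (T I : Type) (A : I -> set T) m
    (f : {nonneg R} -> {nonneg R}) :
  (forall rho, exists c : I -> 'I_m.+1, forall a M, (f rho%:R%:nng)%:num = M%:R ->
     bounded (walk A) (walk A rho) (fun v => c v = a) M) ->
  (forall rho, exists M, (f rho%:R%:nng)%:num = M%:R) ->
  control_function (@graph_dist R (intersection_graph A)) m f.
Proof.
move=> col fnat rho rho0; have [c Hc] := col rho; have [M fM] := fnat rho.
pose comp a x : set I := [set y | chain (walk A rho) (fun v => c v = a) x y].
have comp_eq a x y u v : comp a x u -> comp a y v -> walk A rho u v ->
    comp a x = comp a y.
  move=> xu yv uv; have sym := @walk_sym _ _ A rho.
  have xy : chain (walk A rho) (fun v => c v = a) x y.
    apply: (chain_trans xu); apply: (chain_cons (chain_last xu) uv).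
    exact: chain_sym yv.
  apply/seteqP; split=> z /= xz.
    by apply: chain_trans xz; exact: chain_sym xy.
  exact: chain_trans xy xz.
exists (fun a => [set comp a x | x in [set x | c x = a]]); split.
- move=> x; exists (c x), (comp (c x) x); split; first by exists x.
  exact: chain_nil.
- move=> a _ [x xa <-]; apply: ge_ereal_sup => _ [u xu [v xv <-]].
  have uv : chain (walk A rho) (fun v => c v = a) u v.
    by apply: chain_trans xv; apply: chain_sym xu; exact: walk_sym.
  have [k [kM kp]] := walk_is_path (Hc a M fM _ _ uv).
  apply: (le_trans (ereal_inf_lbound _)); first by exists k.
  by rewrite fM lee_fin ler_nat.
- move=> a _ _ [x xa <-] [y ya <-] ne.
  (* Distances are integers, so [rho.+1] bounds the infimum and makes the inequality strict. *)
  apply: (@lt_le_trans _ _ (rho.+1%:R)%:E); first by rewrite lte_fin ltr_nat.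
  apply: le_ereal_inf_tmp => _ [u xu [v yv <-]].
  apply: le_ereal_inf_tmp => _ [k [p kp] <-].
  rewrite lee_fin ler_nat ltnNge; apply/negP => krho; apply: ne.
  by apply: comp_eq xu yv _; exact: walk_leS krho (is_path_walk kp).
Qed.

Theorem corollary1p6 (R : realType) (n : nat) (r : R)
    (hn : (0 < n)%N) (hr : 1 <= r) :
  asdim_le R
    (intersection_graphs (fun S : set 'rV[R]_n =>
       [/\ compact S, convex_set S & aspect_ratio_le r S]))
    (n + 1)%N.
Proof.
have [N [N0 HN]] := aspect_ratio_fat hn hr.
(* [rho.+1] pays for the extra step in finite subfamilies; [Num.trunc] below recovers [rho] from the
   real argument. *)
have [M HM] := choice (fun rho => fat_family_coloring n rho.+1 N0).
exists (fun x => (M (Num.trunc x%:num))%:R%:nng) => _ [I [A [PA ->]]].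
have [D fatA] := choice (fun i => let: And3 cA vA aA := PA i in HN _ cA vA aA).
rewrite addn1; apply: control_of_coloring => rho; last first.
  by exists (M rho); rewrite /= natrK.
have A0 i : A i !=set0 by case: (fatA i).
have [] := @finite_to_infinite _ _ A A0 'I_n.+2 ord0 rho (M rho).
  by move=> V g; apply: (HM rho R V (A \o g) (D \o g)) => v; exact: fatA.
move=> c Hc; exists c => a M'; rewrite /= natrK => /eqP.
by rewrite eqr_nat => /eqP <-; exact: Hc.
Qed.
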